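(* Let $V=\mathbb{C}^n$, let $\boldsymbol\alpha=(\alpha^1,\dots,\alpha^m)$ be a list of Schubert conditions in $\binom{[n]}{k}$, and let $F^1_\bullet,\dots,F^m_\bullet$ be sufficiently general flags in $V$. The intersection $$X:=X^\circ_{\alpha^1}F^1_\bullet\cap\cdots\cap X^\circ_{\alpha^m}F^m_\bullet$$ is (via the dual diagonal map $\Delta^m$) the solution set of the system of bilinear equations $$M\,F^1\,\widehat F^{i}\,N_i=0_{k\times(n-k)},\qquad i=2,\dots,m,$$ in the unknowns $(M,N_2,\dots,N_m)\in \mathrm S_{\alpha^1}\times\widehat{\mathrm S}_{(\alpha^2)^\perp}\times\cdots\times\widehat{\mathrm S}_{(\alpha^m)^\perp}$; that is, $(M,N_2,\dots,N_m)\mapsto(\operatorname{rowspace}(MF^1),\operatorname{colspace}(\widehat F^2N_2),\dots,\operatorname{colspace}(\widehat F^mN_m))$ maps the solution set bijectively onto $\Delta^m(X)$. This formulates $X$ using $k(n-k)(m-1)$ equations in an affine space of dimension $k(n-k)m-|\boldsymbol\alpha|$. In particular, if $\boldsymbol\alpha$ is a Schubert problem, then $X=X_{\alpha^1}F^1_\bullet\cap\cdots\cap X_{\alpha^m}F^m_\bullet$, and $X$ is formulated as the set of solutions to a square system of equations (the number of equations equals the number of variables).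
   Context: $V=\mathbb{C}^n$ is the space of row vectors, $V^*$ the dual space of column vectors, $0<k<n$. $\binom{[n]}{k}$ is the set of increasing $k$-tuples $\alpha=(\alpha_1<\dots<\alpha_k)$ from $[n]$ (Schubert conditions). For a complete flag $F_\bullet$ in $V$ ($\dim F_i=i$), $X_\alpha F_\bullet=\{H\in \mathrm{Gr}(k,V):\dim(H\cap F_{\alpha_i})\ge i,\ i\in[k]\}$, of codimension $|\alpha|=k(n-k)-\sum_i(\alpha_i-i)$. $|\boldsymbol\alpha|=\sum_i|\alpha^i|$; $\boldsymbol\alpha$ is a Schubert problem if $|\boldsymbol\alpha|=k(n-k)$. $\alpha^\perp\in\binom{[n]}{n-k}$ is the increasing rearrangement of $\{n+1-j:j\in[n]\setminus\alpha\}$. For $H\in \mathrm{Gr}(k,V)$, $H^\perp\in \mathrm{Gr}(n-k,V^* )$ is its annihilator, and $\Delta^m(H)=(H,H^\perp,\dots,H^\perp)\in \mathrm{Gr}(k,V)\times \mathrm{Gr}(n-k,V^* )^{m-1}$. Coordinates: $\mathrm S_\alpha$ is the affine space of $k\times n$ matrices with $M_{i,\alpha_j}=\delta_{ij}$ and $M_{i,j}=0$ for $j>\alpha_i$, other entries arbitrary. For $\beta\in\binom{[n]}{n-k}$, $\widehat{\mathrm S}_\beta$ is the affine space of $n\times(n-k)$ matrices with $N_{n+1-\beta_i,j}=\delta_{ij}$ and $N_{i,j}=0$ for $i<n+1-\beta_j$, other entries arbitrary. For a flag $F_\bullet$, $F$ denotes an invertible $n\times n$ matrix whose first $i$ rows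 span $F_i$ for all $i$, and $\widehat F$ denotes an invertible $n\times n$ matrix whose last $i$ columns span the annihilator $(F_{n-i})^\perp\subset V^*$ for all $i$. $X^\circ_\alpha F_\bullet=\{\operatorname{rowspace}(MF):M\in\mathrm S_\alpha\}$, a dense open subset of $X_\alpha F_\bullet$. *)

(* Defs.v *)
From HB Require Import structures.
From mathcomp Require Import all_boot all_order all_algebra.
From mathcomp Require Import boolp classical_sets functions reals.
From mathcomp Require Import complex mpoly.

Set Implicit Arguments.
Unset Strict Implicit.
Unset Printing Implicit Defensive.

Import GRing.Theory.
Local Open Scope classical_set_scope.
Local Open Scope ring_scope.

(* All indices are 0-based: [tnth a i] is the informal alpha_(i+1) - 1. *)
Record schubert_cond (n k : nat) := SchubertCond {
  sc_tuple :> k.-tuple 'I_n;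
  sc_sorted : sorted (fun i j : 'I_n => (i < j)%N) sc_tuple
}.

(* The 1-based alpha_i - i is the 0-based [tnth a i - i]; both subtractions
   below are exact because [a] is strictly increasing. *)
Definition codim (n k : nat) (a : schubert_cond n k) : nat :=
  (k * (n - k) - \sum_(i < k) (tnth a i - i))%N.

Lemma sc_uniq n k (a : schubert_cond n k) : uniq a.
Proof.
apply: (@sorted_uniq _ (fun i j : 'I_n => (i < j)%N)); last exact: sc_sorted.
- by move=> ? ? ?; apply: ltn_trans.
- by move=> ?; apply: ltnn.
Qed.

(* [rev_ord j] is the 0-based version of n + 1 - j. *)
Definition perp_seq (n k : nat) (a : schubert_cond n k) : seq 'I_n :=
  sort (fun i j : 'I_n => (i <= j)%N) [seq rev_ord j | j <- enum [predC sc_tuple a]].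

Lemma size_perp_seq n k (a : schubert_cond n k) :
  size (perp_seq a) == (n - k)%N.
Proof.
rewrite size_sort size_map -cardE.
have := cardC (mem (sc_tuple a)).
by rewrite card_ord (card_uniqP (sc_uniq a)) size_tuple => /(canRL (addKn _)) ->.
Qed.

Lemma perp_seq_sorted n k (a : schubert_cond n k) :
  sorted (fun i j : 'I_n => (i < j)%N) (perp_seq a).
Proof.
have -> : (fun i j : 'I_n => (i < j)%N) = relpre val ltn by [].
rewrite -sorted_map ltn_sorted_uniq_leq.
rewrite (map_inj_uniq val_inj) sort_uniq (map_inj_uniq rev_ord_inj) enum_uniq /=.
by rewrite sorted_map; apply: sort_sorted => i j; apply: leq_total.
Qed.

Definition sc_perp (n k : nat) (a : schubert_cond n k) :
    schubert_cond n (n - k) :=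
  @SchubertCond n (n - k) (Tuple (size_perp_seq a)) (perp_seq_sorted a).

Definition total_codim (n k m : nat) (a : 'I_m -> schubert_cond n k) : nat :=
  (\sum_(i < m) codim (a i))%N.

Definition schubert_problem (n k m : nat) (a : 'I_m -> schubert_cond n k) :=
  total_codim a = (k * (n - k))%N.

Definition CC (R : realType) : fieldType := R[i].

Section Geometry.
Variable K : fieldType.

Definition rowspace (k n : nat) (A : 'M[K]_(k, n)) : {vspace 'rV[K]_n} :=
  <<[seq row i A | i <- enum 'I_k]>>%VS.

Definition colspace (n l : nat) (A : 'M[K]_(n, l)) : {vspace 'cV[K]_n} :=
  <<[seq col j A | j <- enum 'I_l]>>%VS.

(* Common kernel of the pairings [fun c => h *m c], for [h] in a basis of [H];
   characterized by [annihP] below. *)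
Definition annih (n : nat) (H : {vspace 'rV[K]_n}) : {vspace 'cV[K]_n} :=
  (\bigcap_(h <- vbasis H) lker (linfun (mulmx h : 'cV[K]_n -> 'M[K]_1)))%VS.

Lemma annihP n (H : {vspace 'rV[K]_n}) (c : 'cV[K]_n) :
  reflect (forall h, h \in H -> h *m c = 0) (c \in annih H).
Proof.
have E : (c \in annih H) = all (fun h => h *m c == 0) (vbasis H).
  rewrite /annih; elim: (tval (vbasis H)) => [|h s IHs] /=.
    by rewrite big_nil memvf.
  by rewrite big_cons memv_cap memv_ker lfunE /= IHs.
rewrite E; apply: (iffP allP) => [Z h hH | Z h hb].
  rewrite (coord_vbasis hH) mulmx_suml big1 // => i _.
  by rewrite -scalemxAl (eqP (Z _ (mem_nth _ _))) ?scaler0 // size_tuple.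
by apply/eqP/Z/vbasis_mem.
Qed.

Record flag (n : nat) := Flag {
  flag_space :> 'I_n.+1 -> {vspace 'rV[K]_n};
  flag_dim : forall i, \dim (flag_space i) = i;
  flag_sub : forall i j : 'I_n.+1,
    (i <= j)%N -> (flag_space i <= flag_space j)%VS
}.

Definition flag_matrix (n : nat) (F : flag n) (A : 'M[K]_n) : Prop :=
  A \in unitmx /\
  forall i : 'I_n.+1, <<[seq row j A | j : 'I_n <- enum 'I_n & (j < i)%N]>>%VS = F i.

(* [rev_ord i : 'I_n.+1] has value n - i. *)
Definition dual_flag_matrix (n : nat) (F : flag n) (A : 'M[K]_n) : Prop :=
  A \in unitmx /\
  forall i : 'I_n.+1,
    <<[seq col j A | j : 'I_n <- enum 'I_n & (n - i <= j)%N]>>%VS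
      = annih (F (rev_ord i)).

Definition S_space (n k : nat) (a : schubert_cond n k) : set 'M[K]_(k, n) :=
  [set M | (forall i j : 'I_k, M i (tnth a j) = (i == j)%:R) /\
           (forall (i : 'I_k) (j : 'I_n), (tnth a i < j)%N -> M i j = 0)].

Definition Shat_space (n l : nat) (b : schubert_cond n l) : set 'M[K]_(n, l) :=
  [set N | (forall i j : 'I_l, N (rev_ord (tnth b i)) j = (i == j)%:R) /\
           (forall (i : 'I_n) (j : 'I_l),
              (i < rev_ord (tnth b j))%N -> N i j = 0)].

(* The 1-based F_(alpha_i) is the member of the flag of index [tnth a i + 1],
   that is, [lift ord0 (tnth a i)]. *)
Definition schubert_variety (n k : nat) (a : schubert_cond n k) (F : flag n) :
    set {vspace 'rV[K]_n} :=
  [set H | \dim H = k /\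
     forall i : 'I_k, (i < \dim (H :&: F (lift ord0 (tnth a i))))%N].

(* The set does not depend on the choice of the matrix of the flag. *)
Definition open_schubert (n k : nat) (a : schubert_cond n k) (F : flag n) :
    set {vspace 'rV[K]_n} :=
  [set H | exists A M, [/\ flag_matrix F A, S_space a M
                         & H = rowspace (M *m A)]].

Section General.
Variables n m : nat.

Definition entries (A : 'I_m -> 'M[K]_n) :
    'I_#|{: 'I_m * 'I_n * 'I_n}| -> K :=
  fun v => let: (i, r, c) := enum_val v in A i r c.

(* Zariski topology on the m-fold product of the flag variety GL_n / B: a set
   of m-tuples of flags is open when its preimage in GL_n ^ m is the locus
   where some family of polynomials in the matrix entries does not vanish
   identically. *)
Definition zariski_open (U : set ('I_m -> flag n)) : Prop :=
  exists S : set {mpoly K[#|{: 'I_m * 'I_n * 'I_n}|]},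
    forall (F : 'I_m -> flag n) (A : 'I_m -> 'M[K]_n),
      (forall i, flag_matrix (F i) (A i)) ->
      (U F <-> exists2 p, S p & p.@[entries A] != 0).

Definition for_general_flags (P : ('I_m -> flag n) -> Prop) : Prop :=
  exists U : set ('I_m -> flag n),
    [/\ zariski_open U, U !=set0 & forall F, U F -> P F].

End General.

Definition affine_space_of_dim (V : vectType K) (S : set V) (d : nat) : Prop :=
  exists (x0 : V) (W : {vspace V}),
    \dim W = d /\ S = [set x | x - x0 \in W].

(* A list of m + 1 conditions (so the informal m is [m.+1]) is indexed by
   ['I_m.+1]; index [ord0] is the first condition and [lift ord0 i], for
   [i : 'I_m], the remaining ones. *)
Section System.
Variables n k m : nat.

(* (M, (N_2, ..., N_(m+1))) *)
Definition unknowns : Type :=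
  ('M[K]_(k, n) * {ffun 'I_m -> 'M[K]_(n, n - k)})%type.

Definition coordinates (a : 'I_m.+1 -> schubert_cond n k) : set unknowns :=
  [set x : unknowns | S_space (a ord0) x.1 /\
           forall i : 'I_m, Shat_space (sc_perp (a (lift ord0 i))) (x.2 i)].

Definition solutions (a : 'I_m.+1 -> schubert_cond n k)
    (F1 : 'M[K]_n) (Fhat : 'I_m -> 'M[K]_n) : set unknowns :=
  [set x : unknowns | coordinates a x /\
           forall i : 'I_m, x.1 *m F1 *m Fhat i *m x.2 i = 0].

(* The scalar equations making up the system: entry (r, c) of the i-th matrix
   equation. *)
Definition eqn_index : finType := ('I_m * 'I_k * 'I_(n - k))%type.

Definition bilin_eqn (F1 : 'M[K]_n) (Fhat : 'I_m -> 'M[K]_n) (e : eqn_index)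
    (M : 'M[K]_(k, n)) (N : 'M[K]_(n, n - k)) : K :=
  (M *m F1 *m Fhat e.1.1 *m N) e.1.2 e.2.

Definition subspaces_of (F1 : 'M[K]_n) (Fhat : 'I_m -> 'M[K]_n)
    (x : unknowns) : {vspace 'rV[K]_n} * {ffun 'I_m -> {vspace 'cV[K]_n}} :=
  (rowspace (x.1 *m F1), [ffun i => colspace (Fhat i *m x.2 i)]).

Definition dual_diagonal (H : {vspace 'rV[K]_n}) :
    {vspace 'rV[K]_n} * {ffun 'I_m -> {vspace 'cV[K]_n}} :=
  (H, [ffun => annih H]).

End System.
End Geometry.

(* Main.v *)
(** The bijection is linear algebra, valid for all flags.  With A = Fhat^-1 as
    matrix of the flag, H = rowspace (M A) has annihilator colspace (Fhat N) iff
    M N = 0, and M |-> N with M N = 0 matches S_alpha with Shat_(alpha^perp).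

    For general flags and a Schubert problem, a point of the closed intersection
    outside the open one lies in open cells whose codimensions add up to more
    than k (n - k).  Tuples of matrices of flags for which such cells meet are
    polynomial images of an affine space of too small a dimension: if
    H = rowspace h, then M A^i = g h expresses the pivot rows of A^i as
    polynomials in h, g, the free entries of M and the remaining rows of A^i.
    Counting monomials yields a nonzero polynomial vanishing on each of these
    finitely many images, and flags outside the zero locus are general. *)

Require Import Defs.
From HB Require Import structures.
From mathcomp Require Import all_boot all_order all_algebra.
From mathcomp Require Import boolp classical_sets functions reals.
From mathcomp Require Import complex mpoly zify.

Set Implicit Arguments.
Unset Strict Implicit.
Unset Printing Implicit Defensive.

Import GRing.Theory.
Local Open Scope classical_set_scope.
Local Open Scope ring_scope.

(** * Polynomials: nonvanishing points and algebraic dependence *)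

Lemma base_expansion_inj (B d : nat) (u v : 'I_d -> nat) :
    (forall i, u i < B)%N -> (forall i, v i < B)%N ->
  (\sum_(i < d) u i * B ^ i = \sum_(i < d) v i * B ^ i)%N -> u =1 v.
Proof.
elim: d u v => [|d IH] u v uB vB; first by move=> _ [].
have split_sum (w : 'I_d.+1 -> nat) : (\sum_(i < d.+1) w i * B ^ i =
    w ord0 + (\sum_(i < d) w (lift ord0 i) * B ^ i) * B)%N.
  rewrite big_ord_recl expn0 muln1 big_distrl /=; congr (_ + _)%N.
  by apply: eq_bigr => i _; rewrite /= /bump /= add1n expnSr mulnA.
have B_gt0 : (0 < B)%N by apply: leq_ltn_trans (uB ord0).
rewrite !split_sum => eq_uv.
have /(congr1 (modn^~ B)) := eq_uv.
rewrite !(addnC _ (_ * B)%N) !modnMDl !modn_small // => eq0.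
move: eq_uv; rewrite eq0 => /addnI/eqP; rewrite eqn_pmul2r // => /eqP eqS.
move=> i; case: (unliftP ord0 i) => [j ->|-> //].
by apply: (IH (fun j => u (lift ord0 j)) (fun j => v (lift ord0 j))).
Qed.

(* Kronecker substitution: evaluating at the powers t, t^B, t^(B^2), ... of a
   single scalar sends distinct monomials to distinct powers of t once B
   exceeds the degree. *)
Lemma mpoly_nonvanishing (K : fieldType) (d : nat) (p : {mpoly K[d]}) :
  [pchar K] =i pred0 -> p != 0 -> exists v : 'I_d -> K, p.@[v] != 0.
Proof.
move=> /pcharf0P char0 p_neq0; set B := msize p.
pose wt (m : 'X_{1..d}) := (\sum_(i < d) m i * B ^ i)%N.
pose q : {poly K} := \sum_(m <- msupp p) p@_m *: 'X^(wt m).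
have le_mdeg (m : 'X_{1..d}) i : (m i <= mdeg m)%N.
  by rewrite mdegE (bigD1 i) //= leq_addr.
have q_eval t : q.[t] = p.@[fun i => t ^+ (B ^ i)].
  rewrite mevalE horner_sum; apply: eq_bigr => m _.
  rewrite hornerZ hornerXn expr_sum; congr (_ * _).
  by apply: eq_bigr => i _; rewrite mulnC exprM.
have q_neq0 : q != 0.
  have lead_supp : mlead p \in msupp p by rewrite mlead_supp.
  apply: contra_neq (p_neq0) => q0.
  have: q`_(wt (mlead p)) = 0 by rewrite q0 coef0.
  (* Distinct monomials of [p] have distinct weights, so only the leading one contributes to this
     coefficient. *)
  rewrite coef_sum (bigD1_seq (mlead p)) //= big_seq_cond big1.
    rewrite addr0 coefZ coefXn eqxx mulr1 => /eqP.
    by rewrite mleadc_eq0 => /eqP.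
  move=> m /andP[m_supp m_neq]; rewrite coefZ coefXn.
  case: eqP => [/base_expansion_inj eq_m|_]; last by rewrite mulr0.
  case/eqP: m_neq; apply/mnmP => i.
  by rewrite eq_m // => j; apply: leq_ltn_trans (le_mdeg _ _) (msize_mdeg_lt _).
(* In characteristic zero these are [size q] distinct scalars, one more than the degree of [q], so
   they cannot all be roots. *)
pose s := [seq (i%:R : K) | i <- iota 0 (size q)].
have s_uniq : uniq s.
  rewrite map_inj_in_uniq ?iota_uniq // => i j _ _.
  wlog le_ij : i j / (i <= j)%N => [th|/eqP].
    by case: (leqP i j) => [/th//|/ltnW/th th' /esym/th' ->].
  rewrite eq_sym -subr_eq0 -natrB // char0 subn_eq0 => le_ji.
  by apply/eqP; rewrite eqn_leq le_ij.
have: ~~ all (root q) s.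
  apply/negP => /(max_poly_roots q_neq0)/(_ s_uniq).
  by rewrite size_map size_iota ltnn.
case/allPn => t _ t_nonroot; exists (fun i : 'I_d => t ^+ (B ^ i)).
by rewrite -q_eval.
Qed.

(* There are D^N monomials of degree < D in each of the N variables of p,
   whereas the substituted polynomials involve only O(D^d) monomials. *)
Lemma algebraic_dependence (K : fieldType) (d N : nat) (f : 'I_N -> {mpoly K[d]}) :
  (d < N)%N -> exists2 p : {mpoly K[N]}, p != 0 &
    forall v : 'I_d -> K, p.@[fun j => (f j).@[v]] = 0.
Proof.
(* The constants are chosen so that [N * (D * e + 2) + 1 <= B], which bounds the size of every
   product [F u], and [B ^ d = c ^ d * D ^ d < D ^ d.+1 <= D ^ N]. *)
move=> lt_dN; set e := (\max_(j < N) msize (f j)).+1.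
pose c := (N * (e + 2) + 1)%N; pose D := (c ^ d).+1; pose B := (c * D)%N.
have c_gt0 : (0 < c)%N by rewrite /c addn1.
pose rows := {ffun 'I_N -> 'I_D}; pose cols := {ffun 'I_d -> 'I_B}.
pose F (u : rows) : {mpoly K[d]} := \prod_j f j ^+ u j.
pose C : 'M[K]_(#|rows|, #|cols|) :=
  \matrix_(u, w) (F (enum_val u))@_[multinom ((enum_val w : cols) i : nat) | i < d].
have msize_exp (j : 'I_N) (r : nat) : (msize (f j ^+ r) <= r * e + 1)%N.
  elim: r => [|r IHr]; first by rewrite expr0 msize1.
  rewrite exprS; apply: leq_trans (msizeM_le _ _) _.
  have le_e : (msize (f j) < e)%N by rewrite ltnS (leq_bigmax j).
  by move: IHr le_e; rewrite mulSn; lia.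
have msize_F u : (msize (F u) <= B)%N.
  have msize_prod (r : seq 'I_N) :
      (msize (\prod_(j <- r) f j ^+ u j) <= size r * (D * e + 2) + 1)%N.
    elim: r => [|j r IHr]; first by rewrite big_nil msize1.
    rewrite big_cons; apply: leq_trans (msizeM_le _ _) _.
    have := leq_add (msize_exp j (u j)) IHr.
    have: (u j * e <= D * e)%N by rewrite leq_mul2r ltnW ?orbT.
    by move: (u j * e)%N (D * e)%N => x y /=; lia.
  have := msize_prod (enum 'I_N); rewrite big_enum size_enum_ord.
  move=> /leq_trans -> //.
  by rewrite /B /c; nia.
have lt_cols_rows : (#|cols| < #|rows|)%N.
  rewrite !card_ffun !card_ord /B expnMn.
  apply: (@leq_trans (D * D ^ d)); first by rewrite ltn_pmul2r ?expn_gt0.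
  by rewrite -expnS leq_pexp2l.
have [z z_neq0 zC] : exists2 z : 'rV[K]_#|rows|, z != 0 & z *m C = 0.
  have : kermx C != 0.
    rewrite kermx_eq0 /row_free eqn_leq negb_and -!ltnNge.
    by rewrite (leq_ltn_trans (rank_leq_col C)) ?orbT.
  case/rowV0Pn => z /sub_kermxP zC z_neq0; by exists z.
pose mon (u : rows) : 'X_{1..N} := [multinom (u j : nat) | j < N].
have mon_inj : injective mon.
  move=> u u' /mnmP eq_uu'; apply/ffunP => j; apply: val_inj.
  by have := eq_uu' j; rewrite !mnmE.
(* A linear relation among the products [F u] is a polynomial relation among the [f j]; it is
   nonzero since distinct [u] give distinct monomials. *)
exists (\sum_u z 0 u *: 'X_[mon (enum_val u)]).
  apply: contra_neq z_neq0 => p0; apply/rowP => u; rewrite mxE.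
  have := congr1 (mcoeff (mon (enum_val u))) p0.
  rewrite mcoeff0 linear_sum (bigD1 u) //= big1 => [|u' neq_u].
    by rewrite addr0 mcoeffZ mcoeffX eqxx mulr1.
  rewrite mcoeffZ mcoeffX (inj_eq mon_inj) (inj_eq enum_val_inj).
  by rewrite (negPf neq_u) mulr0.
have comp0 : \sum_u z 0 u *: F (enum_val u) = 0.
  apply/mpolyP => m; rewrite mcoeff0 linear_sum /=.
  have [lt_mB|le_Bm] := ltnP (mdeg m) B; last first.
    apply: big1 => u _; rewrite mcoeffZ (memN_msupp_eq0 (msize_mdeg_ge _)) ?mulr0 //.
    exact: leq_trans le_Bm.
  have lt_m i : (m i < B)%N.
    by apply: leq_ltn_trans lt_mB; rewrite mdegE (bigD1 i) //= leq_addr.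
  pose w : cols := [ffun i => Ordinal (lt_m i)].
  have /rowP/(_ (enum_rank w)) := zC; rewrite !mxE => zCw; rewrite -[RHS]zCw.
  apply: eq_bigr => u _; rewrite mcoeffZ !mxE; congr (_ * _@__).
  by apply/mnmP => i; rewrite mnmE enum_rankK ffunE.
move=> v; rewrite linear_sum /= -[RHS](meval0 v) -comp0 linear_sum /=.
apply: eq_bigr => u _; rewrite !mevalZ mevalX rmorph_prod; congr (_ * _).
by apply: eq_bigr => j _; rewrite rmorphXn mnmE.
Qed.

(** * Combinatorics of Schubert conditions and their codimension *)

HB.instance Definition _ n k := [isSub for @sc_tuple n k].
HB.instance Definition _ n k := [Finite of schubert_cond n k by <:].

Lemma card_ord_lt (n d : nat) : (d <= n)%N -> #|[pred i : 'I_n | (i < d)%N]| = d.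
Proof.
move=> le_dn; rewrite -sum1_card (eq_bigl (fun i : 'I_n => (i < d)%N)) //.
by rewrite (big_ord_narrow le_dn) sum1_card card_ord.
Qed.

Lemma card_pred_fibers (I T : finType) (P : I -> pred T) :
  #|[pred t : I * T | P t.1 t.2]| = (\sum_i #|P i|)%N.
Proof.
rewrite -sum1_card (eq_bigl (fun t => xpredT t.1 && P t.1 t.2)) //.
rewrite -(pair_big_dep xpredT P (fun _ _ => 1%N)) /=.
by apply: eq_bigr => i _; rewrite sum1_card.
Qed.

Section SchubertConditions.
Variables n k : nat.
Implicit Types b : schubert_cond n k.

(* Lists the complement of [b] in decreasing order. *)
Definition perp_elt b (j : 'I_(n - k)) : 'I_n := rev_ord (tnth (sc_perp b) j).

(* The free entries of [S_space b] and of [Shat_space (sc_perp b)] are both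
   indexed by the pairs (x, c) with x in b, c not in b and c < x. *)
Definition descents b : pred ('I_n * 'I_n) :=
  [pred p | [&& p.1 \in tval b, p.2 \notin tval b & (p.2 < p.1)%N]].

Definition ascents b : pred ('I_n * 'I_n) :=
  [pred p | [&& p.1 \in tval b, p.2 \notin tval b & (p.1 < p.2)%N]].

Lemma sc_le b : (k <= n)%N.
Proof.
have := max_card (mem (tval b)).
by rewrite (card_uniqP (sc_uniq b)) size_tuple card_ord.
Qed.

Lemma sc_inj b : injective (tnth b).
Proof. by apply/tuple_uniqP; apply: sc_uniq. Qed.

Lemma sc_lt b (i j : 'I_k) : (tnth b i < tnth b j)%N = (i < j)%N.
Proof.
have homo (x y : 'I_k) : (x < y)%N -> (tnth b x < tnth b y)%N.
  have z := tnth b x; move=> lt_xy; rewrite !(tnth_nth z).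
  apply: (sorted_ltn_nth _ _ (sc_sorted b)); rewrite ?inE ?size_tuple //.
  by move=> u v w; apply: ltn_trans.
case: (ltngtP i j) => [/homo-> //|/homo|/val_inj->]; last exact: ltnn.
by move/ltnW; rewrite ltnNge => ->.
Qed.

Lemma card_sc_lt b (i : 'I_k) : #|[pred j | (tnth b j < tnth b i)%N]| = i.
Proof.
rewrite -[RHS](card_ord_lt (ltnW (ltn_ord i))).
by apply: eq_card => j; rewrite !inE sc_lt.
Qed.

Lemma perp_eltP b c : reflect (exists j, c = perp_elt b j) (c \notin tval b).
Proof.
have mem_perp d : (d \in perp_seq b) = (rev_ord d \notin tval b).
  rewrite mem_sort; apply/mapP/idP => [[x]|d_notin].
    by rewrite mem_enum => xb ->; rewrite rev_ordK.
  by exists (rev_ord d); rewrite ?rev_ordK // mem_enum.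
apply: (iffP idP) => [c_notin|[j ->]].
  have : rev_ord c \in tval (sc_perp b) by rewrite /= mem_perp rev_ordK.
  by case/tnthP => j cE; exists j; rewrite /perp_elt -cE rev_ordK.
by rewrite -mem_perp; apply: mem_tnth.
Qed.

Lemma perp_elt_notin b j : perp_elt b j \notin tval b.
Proof. by apply/perp_eltP; exists j. Qed.

Lemma perp_elt_inj b : injective (perp_elt b).
Proof.
by move=> i j /rev_ord_inj; have /tuple_uniqP := sc_uniq (sc_perp b); apply.
Qed.

Lemma perp_elt_neq b i j : (tnth b i == perp_elt b j) = false.
Proof.
by apply: contraNF (perp_elt_notin b j) => /eqP <-; apply: mem_tnth.
Qed.

Lemma card_sc_complement b : #|[predC tval b]| = (n - k)%N.
Proof.
have := cardC (mem (tval b)).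
by rewrite card_ord (card_uniqP (sc_uniq b)) size_tuple => /(canRL (addKn _)) ->.
Qed.

Lemma sum_sc b (f : 'I_n -> nat) :
  (\sum_(x in tval b) f x = \sum_(i < k) f (tnth b i))%N.
Proof. by rewrite -big_uniq ?sc_uniq //= big_tuple. Qed.

Lemma card_pairs_from b (r : rel 'I_n) :
  #|[pred p | [&& p.1 \in tval b, p.2 \notin tval b & r p.1 p.2]]| =
  (\sum_(i < k) #|[pred c | (c \notin tval b) && r (tnth b i) c]|)%N.
Proof.
rewrite -(sum_sc b (fun x => #|[pred c | (c \notin tval b) && r x c]|)).
rewrite -sum1_card (eq_bigl (fun p => (p.1 \in tval b) &&
  ((p.2 \notin tval b) && r p.1 p.2))); last by [].
rewrite -(pair_big_dep (mem (tval b)) (fun x c => (c \notin tval b) && r x c)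
  (fun _ _ => 1%N)) /=.
by apply: eq_bigr => x _; rewrite sum1_card.
Qed.

(** Of the [tnth b i] indices below [tnth b i], exactly [i] belong to [b]; the others are the second
    components of the descents from [tnth b i]. *)
Lemma card_descents b : #|descents b| = (\sum_(i < k) (tnth b i - i))%N.
Proof.
rewrite (card_pairs_from b (fun x c => (c < x)%N)); apply: eq_bigr => i _.
have := cardID (mem (tval b)) [pred c : 'I_n | (c < tnth b i)%N].
rewrite (card_ord_lt (ltnW (ltn_ord _))) [X in (X + _)%N](_ : _ = i :> nat).
  by move=> sumE; rewrite -[X in (X - _)%N]sumE addKn;
    apply: eq_card => c; rewrite !inE.
rewrite -[RHS](card_sc_lt b) -[RHS](card_image (@sc_inj b)); apply: eq_card => c.
apply/idP/fintype.imageP => [|[j lt_j ->]]; last first.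
  by move: lt_j; rewrite !inE mem_tnth => ->.
by rewrite !inE => /andP[lt_c /tnthP[j cE]]; exists j; rewrite ?inE // -cE.
Qed.

Lemma card_descents_ascents b : (#|descents b| + #|ascents b| = k * (n - k))%N.
Proof.
rewrite (card_pairs_from b (fun x c => (c < x)%N)).
rewrite (card_pairs_from b (fun x c => (x < c)%N)) -big_split /=.
rewrite (eq_bigr (fun=> (n - k)%N)) ?sum_nat_const ?card_ord // => i _.
rewrite -(card_sc_complement b) -[RHS](cardID [pred c : 'I_n | (c < tnth b i)%N]).
congr (_ + _)%N; apply: eq_card => c; rewrite !inE //.
rewrite -leqNgt [in RHS]leq_eqVlt; case: eqP => //= [/ord_inj <-|_].
  by rewrite mem_tnth.
by rewrite andbC.
Qed.

(** The codimension becomes a number of matrix positions, as needed for the parameter count. *)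
Lemma codimE b : codim b = #|ascents b|.
Proof. by rewrite /codim -card_descents -(card_descents_ascents b) addKn. Qed.

Lemma codim_descents b : (codim b + #|descents b| = k * (n - k))%N.
Proof. by rewrite codimE addnC card_descents_ascents. Qed.

Lemma codim_le b b' : (forall i, tnth b i <= tnth b' i)%N -> (codim b' <= codim b)%N.
Proof.
move=> le_bc; apply: leq_sub2l; apply: leq_sum => i _; exact: leq_sub2r.
Qed.

Lemma sc_ge b (i : 'I_k) : (i <= tnth b i)%N.
Proof.
rewrite -{1}(card_sc_lt b i) -(card_image (@sc_inj b)).
apply: (@leq_trans #|[pred c : 'I_n | (c < tnth b i)%N]|).
  by apply/subset_leq_card/fintype.subsetP => c /fintype.imageP[j lt_j ->].
by rewrite (card_ord_lt (ltnW (ltn_ord _))).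
Qed.

(** The codimension strictly decreases when an entry grows: by [sc_ge] the differences
    [tnth b i - i] are exact, so a smaller entry is not hidden by truncation. *)
Lemma codim_le_eq b b' : (forall i, tnth b i <= tnth b' i)%N ->
  (codim b <= codim b')%N -> b = b'.
Proof.
move=> le_bc le_cod; apply/val_inj/eq_from_tnth => i; apply/val_inj/eqP => /=.
rewrite eqn_leq le_bc /=.
have: (\sum_(j < k) (tnth b' j - j) <= \sum_(j < k) (tnth b j - j))%N.
  rewrite -!card_descents; have := codim_descents b; have := codim_descents b'; lia.
rewrite (bigD1 i) //= [X in (_ <= X)%N](bigD1 i) //=.
have: (\sum_(j < k | j != i) (tnth b j - j) <=
       \sum_(j < k | j != i) (tnth b' j - j))%N.
  by apply: leq_sum => j _; apply: leq_sub2r.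
move: (\sum_(j < k | j != i) _)%N => x; move: (\sum_(j < k | j != i) _)%N => y.
by have := sc_ge b i; have := sc_ge b' i; lia.
Qed.

End SchubertConditions.

(** * Spans, row and column spaces, annihilators *)

Section LinearAlgebra.
Variable K : fieldType.

Lemma mem_span_map (V : vectType K) (I : eqType) (g : I -> V) (s : seq I) v :
  uniq s -> reflect (exists x : I -> K, v = \sum_(j <- s) x j *: g j)
                    (v \in <<[seq g j | j <- s]>>%VS).
Proof.
move=> s_uniq; apply: (iffP idP) => [|[x ->]]; last first.
  rewrite big_seq; apply: memv_suml => j js.
  by rewrite memvZ // memv_span // map_f.
elim: s s_uniq v => [|i s IHs] /= s_uniq v.
  rewrite span_nil memv0 => /eqP ->; exists (fun=> 0); by rewrite big_nil.
case/andP: s_uniq => i_notin s_uniq.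
rewrite span_cons => /memv_addP[_ /vlineP[c ->] [w /(IHs s_uniq)[x ->] ->]].
exists (fun j => if j == i then c else x j); rewrite big_cons eqxx; congr (_ + _).
apply: eq_big_seq => j js; case: eqP => // ji.
by rewrite -ji js in i_notin.
Qed.

Lemma free_map (V : vectType K) (I : eqType) (g : I -> V) (s : seq I) :
    uniq s ->
    (forall x : I -> K, \sum_(j <- s) x j *: g j = 0 -> {in s, forall j, x j = 0}) ->
  free [seq g j | j <- s].
Proof.
elim: s => [|i s IHs] /=; first by rewrite nil_free.
case/andP=> i_notin s_uniq indep; rewrite free_cons; apply/andP; split.
  apply/negP => /(mem_span_map _ _ s_uniq)[x giE].
  have := indep (fun j => if j == i then -1 else x j) _ i (mem_head _ _).
  rewrite big_cons eqxx scaleN1r giE => indep_i.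
  have /eqP : (-1 : K) = 0; last by rewrite oppr_eq0 oner_eq0.
  apply: indep_i; apply/eqP; rewrite addrC subr_eq0; apply/eqP.
  apply: eq_big_seq => j js; case: eqP => // ji.
  by rewrite -ji js in i_notin.
apply: IHs => // x x0 j js.
have := indep (fun j => if j == i then 0 else x j) _ j.
rewrite big_cons eqxx scale0r add0r inE js orbT => /(_ _ isT).
case: eqP => [ji|_ -> //]; first by rewrite -ji js in i_notin.
rewrite -[RHS]x0; apply: eq_big_seq => l ls; case: eqP => // li.
by rewrite -li ls in i_notin.
Qed.

Section Rows.
Variables (k n : nat) (A : 'M[K]_(k, n)).

(** The filter [P] covers both full row spaces and the spans of initial rows in [flag_matrix]. *)
Lemma mem_span_rowsP (P : pred 'I_k) (v : 'rV[K]_n) :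
  reflect (exists2 x : 'rV_k, (forall j, ~~ P j -> x 0 j = 0) & v = x *m A)
          (v \in <<[seq row j A | j <- enum 'I_k & P j]>>%VS).
Proof.
apply: (iffP (mem_span_map _ _ (filter_uniq _ (enum_uniq _)))).
  case=> x ->; exists (\row_j if P j then x j else 0) => [j /negPf Pj|].
    by rewrite mxE Pj.
  rewrite mulmx_sum_row big_filter big_enum_cond /= big_mkcond /=.
  by apply: eq_bigr => j _; rewrite mxE; case: ifP; rewrite ?scale0r.
case=> x x0 ->; exists (x 0); rewrite mulmx_sum_row big_filter big_enum_cond /=.
rewrite [RHS]big_mkcond /=; apply: eq_bigr => j _.
by case: ifP => // /negbT /x0 ->; rewrite scale0r.
Qed.

Lemma dim_span_rows (P : pred 'I_k) : row_free A ->
  \dim <<[seq row j A | j <- enum 'I_k & P j]>>%VS = #|P|.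
Proof.
have s_uniq : uniq [seq j <- enum 'I_k | P j] by rewrite filter_uniq ?enum_uniq.
move=> A_free; rewrite (eqnP (free_map s_uniq _)).
  by rewrite size_map enumT [in RHS]cardE.
move=> x; rewrite big_filter big_enum_cond /= big_mkcond /= => x0 j.
rewrite mem_filter => /andP[Pj _].
have : (\row_j if P j then x j else 0) *m A = 0 *m A.
  rewrite mul0mx -[RHS]x0 mulmx_sum_row; apply: eq_bigr => i _; rewrite mxE.
  by case: ifP; rewrite ?scale0r.
by move/(row_free_inj A_free)/rowP/(_ j); rewrite !mxE Pj.
Qed.

Lemma rowspace_predT :
  rowspace A = <<[seq row j A | j <- enum 'I_k & predT j]>>%VS.
Proof. by rewrite filter_predT. Qed.

Lemma mem_rowspace (v : 'rV[K]_n) : (v \in rowspace A) = (v <= A)%MS.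
Proof.
rewrite rowspace_predT; apply/mem_span_rowsP/submxP => [[x _ ->]|[x ->]].
  by exists x.
by exists x.
Qed.

Lemma mem_colspace (v : 'cV[K]_k) : (v \in colspace A) = (v^T <= A^T)%MS.
Proof.
apply/(mem_span_map _ _ (enum_uniq _))/submxP => [[x ->]|[x vE]].
  exists (\row_j x j); rewrite mulmx_sum_row linear_sum /= big_enum /=.
  by apply: eq_bigr => j _; rewrite mxE -tr_col linearZ.
exists (x 0); rewrite -[LHS]trmxK vE mulmx_sum_row linear_sum /= big_enum /=.
by apply: eq_bigr => j _; rewrite linearZ /= -tr_col trmxK.
Qed.

End Rows.

Lemma rowspace_eq k k' n (A : 'M[K]_(k, n)) (B : 'M[K]_(k', n)) :
  rowspace A = rowspace B <-> (A :=: B)%MS.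
Proof.
split=> [eqAB|eqAB]; last by apply/vspaceP => v; rewrite !mem_rowspace eqAB.
apply/eqmxP/andP; split; apply/row_subP => i.
  by rewrite -mem_rowspace -eqAB mem_rowspace row_sub.
by rewrite -mem_rowspace eqAB mem_rowspace row_sub.
Qed.

Lemma colspace_eq n l l' (A : 'M[K]_(n, l)) (B : 'M[K]_(n, l')) :
  colspace A = colspace B <-> (A^T :=: B^T)%MS.
Proof.
split=> [eqAB|eqAB]; last by apply/vspaceP => v; rewrite !mem_colspace eqAB.
apply/eqmxP/andP; split; apply/row_subP => i; rewrite -[row i _]trmxK.
  by rewrite -mem_colspace -eqAB mem_colspace trmxK row_sub.
by rewrite -mem_colspace eqAB mem_colspace trmxK row_sub.
Qed.

Lemma dim_rowspace k n (A : 'M[K]_(k, n)) : \dim (rowspace A) = \rank A.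
Proof.
have -> : rowspace A = rowspace (row_base A).
  by apply/rowspace_eq/eqmx_sym/eq_row_base.
by rewrite rowspace_predT dim_span_rows ?row_base_free // card_ord.
Qed.

Lemma vspace_rowspace n (H : {vspace 'rV[K]_n}) :
  exists2 h : 'M[K]_(\dim H, n), row_free h & H = rowspace h.
Proof.
pose h : 'M[K]_(\dim H, n) := \matrix_i tnth (vbasis H) i.
have HE : H = rowspace h.
  rewrite -{1}(span_basis (vbasisP H)) /rowspace; congr <<_>>%VS.
  rewrite -[LHS]map_tnth_enum; apply: eq_map => i; by rewrite rowK.
by exists h; rewrite // /row_free -dim_rowspace -HE.
Qed.

Lemma annih_rowspace k n (A : 'M[K]_(k, n)) (c : 'cV[K]_n) :
  (c \in annih (rowspace A)) = (A *m c == 0).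
Proof.
apply/annihP/eqP => [Ac0|Ac0 h].
  by apply/row_matrixP => i; rewrite row0 row_mul Ac0 // mem_rowspace row_sub.
by rewrite mem_rowspace => /submxP[x ->]; rewrite -mulmxA Ac0 mulmx0.
Qed.

Lemma annih_eq_mul0 k n l (A : 'M[K]_(k, n)) (B : 'M[K]_(n, l)) :
  annih (rowspace A) = colspace B -> A *m B = 0.
Proof.
move=> annA; apply/matrixP => i j.
have /eqP/matrixP/(_ i 0) : A *m col j B == 0.
  by rewrite -annih_rowspace annA mem_colspace tr_col row_sub.
by rewrite colE mulmxA -colE !mxE.
Qed.

(** [P] lies in the left kernel of [Q], and both have rank [k] because [Q] has rank [n - k]. *)
Lemma eqmx_kermx k n (P : 'M[K]_(k, n)) (Q : 'M[K]_(n, n - k)) :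
  (k <= n)%N -> row_free P -> row_free Q^T -> P *m Q = 0 -> (P :=: kermx Q)%MS.
Proof.
move=> le_kn P_free Q_free PQ0; apply/eqmxP.
have /mxrank_leqif_eq <- : (P <= kermx Q)%MS by apply/sub_kermxP.
by rewrite mxrank_ker -(mxrank_tr Q) (eqP P_free) (eqP Q_free) subKn.
Qed.

Lemma annih_colspace k n (P : 'M[K]_(k, n)) (Q : 'M[K]_(n, n - k)) :
  (k <= n)%N -> row_free P -> row_free Q^T -> P *m Q = 0 ->
  annih (rowspace P) = colspace Q.
Proof.
move=> le_kn P_free Q_free PQ0; apply/vspaceP => c.
rewrite annih_rowspace mem_colspace.
have QE : (Q^T :=: kermx P^T)%MS.
  apply/eqmxP; have /mxrank_leqif_eq <- : (Q^T <= kermx P^T)%MS.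
    by apply/sub_kermxP; rewrite -trmx_mul PQ0 trmx0.
  by rewrite mxrank_ker (eqP Q_free) mxrank_tr (eqP P_free).
rewrite QE; apply/eqP/sub_kermxP => [Pc0|].
  by rewrite -trmx_mul Pc0 trmx0.
by rewrite -trmx_mul => /(congr1 trmx); rewrite trmxK trmx0.
Qed.

End LinearAlgebra.

(** * Reduced matrices, their duality, and echelon form *)

Section Coordinates.
Variables (K : fieldType) (n k : nat).
Implicit Types b : schubert_cond n k.

(** This form exhibits an affine space with one free coordinate per descent: the pivot columns and
    the zeros to the right of the pivots account for all other positions. *)
Lemma S_spaceE b (M : 'M[K]_(k, n)) :
  S_space b M <->
  forall i c, (tnth b i, c) \notin descents b -> M i c = (c == tnth b i)%:R.
Proof.
split=> [[M_id M_0] i c|MD].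
  rewrite inE /= mem_tnth /= negb_and negbK -leqNgt.
  case/orP => [/tnthP[j ->]|]; first by rewrite M_id (inj_eq (@sc_inj _ _ b)) eq_sym.
  rewrite leq_eqVlt => /predU1P[/ord_inj <-|lt_c]; first by rewrite M_id !eqxx.
  by rewrite M_0 //; case: eqP lt_c => // ->; rewrite ltnn.
split=> [i j|i c lt_c].
  by rewrite MD ?inE /= ?mem_tnth // (inj_eq (@sc_inj _ _ b)) eq_sym.
rewrite MD ?inE /= ?(ltnNge c) ?(ltnW lt_c) ?andbF //.
by case: eqP lt_c => // ->; rewrite ltnn.
Qed.

Lemma Shat_spaceE b (N : 'M[K]_(n, n - k)) :
  Shat_space (sc_perp b) N <->
  forall r j, (r, perp_elt b j) \notin descents b -> N r j = (r == perp_elt b j)%:R.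
Proof.
split=> [[N_id N_0] r j|ND].
  rewrite inE /= perp_elt_notin /= negb_and -leqNgt.
  case/orP => [/perp_eltP[i ->]|le_r].
    by rewrite N_id (inj_eq (@perp_elt_inj _ _ b)).
  have [/perp_eltP[i ->]|] := boolP (r \notin tval b).
    by rewrite N_id (inj_eq (@perp_elt_inj _ _ b)).
  rewrite negbK => rb; have neq_r : r != perp_elt b j.
    by apply: contraTneq rb => ->; apply: perp_elt_notin.
  by rewrite N_0 ?(negPf neq_r) // ltn_neqAle neq_r.
split=> [i j|r j lt_r].
  rewrite ND ?(inj_eq (@perp_elt_inj _ _ b)) //.
  by rewrite inE /= (negPf (perp_elt_notin b i)).
rewrite ND ?inE /= ?(ltnNge (perp_elt b j)) ?(ltnW lt_r) ?andbF //.
by case: eqP lt_r => // ->; rewrite ltnn.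
Qed.

(** Left multiplication by [sel b] extracts the rows indexed by [b], right multiplication by
    [cosel b] the columns outside [b]. They are also the points of the two coordinate spaces with
    all free entries zero. *)
Definition sel b : 'M[K]_(k, n) := \matrix_(i, c) (c == tnth b i)%:R.
Definition cosel b : 'M[K]_(n, n - k) := \matrix_(r, j) (r == perp_elt b j)%:R.

Lemma mul_sel b p (A : 'M[K]_(n, p)) i j : (sel b *m A) i j = A (tnth b i) j.
Proof.
rewrite mxE (bigD1 (tnth b i)) //= mxE eqxx mul1r big1 ?addr0 // => c neq_c.
by rewrite mxE (negPf neq_c) mul0r.
Qed.

Lemma mul_tr_sel b p (A : 'M[K]_(p, n)) i j : (A *m (sel b)^T) i j = A i (tnth b j).
Proof.
rewrite mxE (bigD1 (tnth b j)) //= !mxE eqxx mulr1 big1 ?addr0 // => c neq_c.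
by rewrite !mxE (negPf neq_c) mulr0.
Qed.

Lemma mul_tr_sel_l b p (A : 'M[K]_(k, p)) i j :
  ((sel b)^T *m A) (tnth b i) j = A i j.
Proof.
rewrite mxE (bigD1 i) //= !mxE eqxx mul1r big1 ?addr0 // => l neq_l.
by rewrite !mxE (inj_eq (@sc_inj _ _ b)) eq_sym (negPf neq_l) mul0r.
Qed.

Lemma mul_tr_cosel b p (A : 'M[K]_(p, n - k)) i j :
  (A *m (cosel b)^T) i (perp_elt b j) = A i j.
Proof.
rewrite mxE (bigD1 j) //= !mxE eqxx mulr1 big1 ?addr0 // => l neq_l.
by rewrite !mxE (inj_eq (@perp_elt_inj _ _ b)) eq_sym (negPf neq_l) mulr0.
Qed.

Lemma mul_cosel b p (A : 'M[K]_(p, n)) i j : (A *m cosel b) i j = A i (perp_elt b j).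
Proof.
rewrite mxE (bigD1 (perp_elt b j)) //= mxE eqxx mulr1 big1 ?addr0 // => c neq_c.
by rewrite mxE (negPf neq_c) mulr0.
Qed.

Lemma S_space_sel b M : S_space b M -> M *m (sel b)^T = 1%:M.
Proof.
by case=> M_id _; apply/matrixP => i j; rewrite mul_tr_sel mxE M_id.
Qed.

Lemma Shat_space_cosel b N : Shat_space (sc_perp b) N -> (cosel b)^T *m N = 1%:M.
Proof.
case=> N_id _; rewrite -[LHS]trmxK trmx_mul trmxK; apply/matrixP => i j.
by rewrite mxE mul_cosel !mxE N_id.
Qed.

Lemma S_space_free b (M : 'M[K]_(k, n)) : S_space b M -> row_free M.
Proof. by move=> MS; apply/row_freeP; exists (sel b)^T; apply: S_space_sel. Qed.

Lemma Shat_space_free b (N : 'M[K]_(n, n - k)) :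
  Shat_space (sc_perp b) N -> row_free N^T.
Proof.
move=> NS; apply/row_freeP; exists (cosel b).
by rewrite -[cosel b]trmxK -trmx_mul Shat_space_cosel ?trmx1.
Qed.

(** The change of basis [g] can be read off in the pivot columns, where both matrices are the
    identity. *)
Lemma S_space_inj b (M M' : 'M[K]_(k, n)) :
  S_space b M -> S_space b M' -> (M :=: M')%MS -> M = M'.
Proof.
move=> MS M'S eqMM'; have /submxP[g ME] : (M <= M')%MS by rewrite eqMM'.
have := S_space_sel MS; rewrite ME -mulmxA (S_space_sel M'S) mulmx1 => ->.
by rewrite mul1mx.
Qed.

Lemma Shat_space_inj b (N N' : 'M[K]_(n, n - k)) :
    Shat_space (sc_perp b) N -> Shat_space (sc_perp b) N' ->
  (N^T :=: N'^T)%MS -> N = N'.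
Proof.
move=> NS N'S eqNN'; have /submxP[g NE] : (N^T <= N'^T)%MS by rewrite eqNN'.
have {}NE : N = N' *m g^T by rewrite -[N]trmxK NE trmx_mul trmxK.
have := Shat_space_cosel NS; rewrite NE mulmxA (Shat_space_cosel N'S) mul1mx => ->.
by rewrite mulmx1.
Qed.

(** If [M] is the identity on the columns in [b] and a block [Q] on the others, take [N] to be the
    identity on the rows outside [b] and [- Q] on those in [b]. The nonzero entries of [Q] sit at
    descents, which are also the free positions of [N]. *)
Lemma S_space_dual b (M : 'M[K]_(k, n)) : S_space b M ->
  exists2 N : 'M[K]_(n, n - k), Shat_space (sc_perp b) N & M *m N = 0.
Proof.
move=> MS; exists (cosel b - (sel b)^T *m (M *m cosel b)); last first.
  by rewrite mulmxBr (mulmxA M) (S_space_sel MS) mul1mx subrr.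
apply/Shat_spaceE => r j rj; rewrite !mxE big1 ?subr0 // => i _.
rewrite mul_cosel !mxE; case: eqP => [rE|_]; last by rewrite mul0r.
move/S_spaceE: MS => -> ; first by rewrite eq_sym perp_elt_neq mulr0.
by rewrite -rE.
Qed.

Lemma Shat_space_dual b (N : 'M[K]_(n, n - k)) : Shat_space (sc_perp b) N ->
  exists2 M : 'M[K]_(k, n), S_space b M & M *m N = 0.
Proof.
move=> NS; exists (sel b - sel b *m N *m (cosel b)^T); last first.
  by rewrite mulmxBl -(mulmxA _ _ N) (Shat_space_cosel NS) mulmx1 subrr.
apply/S_spaceE => i c ic; rewrite !mxE big1 ?subr0 // => j _.
rewrite mul_sel !mxE; case: eqP => [cE|_]; last by rewrite mulr0.
move/Shat_spaceE: NS => -> ; first by rewrite perp_elt_neq mul0r.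
by rewrite -cE.
Qed.

(* The pivot columns are the positions in which the last nonzero entry of some
   vector of the row space of W occurs. *)
Lemma echelon_form (W : 'M[K]_(k, n)) : row_free W ->
  exists b (M : 'M[K]_(k, n)), S_space b M /\ (M :=: W)%MS.
Proof.
move=> W_free.
pose pivot (v : 'rV[K]_n) c := v 0 c != 0 /\ forall d : 'I_n, (c < d)%N -> v 0 d = 0.
have pivot_ex v : v != 0 -> exists c, pivot v c.
  case/rV0Pn => c0 vc0; pose c := [arg max_(c > c0 | v 0 c != 0) (c : nat)].
  exists c; rewrite /c; case: arg_maxnP => //= d vd d_max; split=> // e lt_de.
  by apply: contraTeq lt_de => /d_max; rewrite leqNgt.
pose S := [pred c : 'I_n | `[< exists2 v : 'rV_n, (v <= W)%MS & pivot v c >]].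
pose s := [tuple of enum S].
have s_sorted : sorted (fun i j : 'I_n => (i < j)%N) s.
  rewrite /= {1}/enum_mem; apply: sorted_filter => [x y z|]; first exact: ltn_trans.
  have := iota_ltn_sorted 0 n; rewrite -val_enum_ord sorted_map enumT.
  by apply: sub_sorted.
have s_mem i : tnth s i \in S by rewrite -mem_enum mem_tnth.
have /choice[V V_P] : forall i, exists v : 'rV_n, (v <= W)%MS /\ pivot v (tnth s i).
  by move=> i; have /asboolP[v vW v_piv] := s_mem i; exists v.
have s_le : (#|S| <= k)%N.
  pose V' : 'M[K]_(#|S|, n) := \matrix_i V i.
  (* Restricted to the pivot columns in increasing order, vectors with these pivots form a lower
     triangular matrix with nonzero diagonal. *)
  have V'_free : row_free V'.
    pose T : 'M[K]_#|S| := \matrix_(i, j) V i 0 (tnth s j).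
    have T_unit : T \in unitmx.
      rewrite unitmxE det_trig; last first.
        apply/is_trig_mxP => i j lt_ij; rewrite mxE.
        have [_ [_ ->]] // := V_P i.
        have z := tnth s i; rewrite !(tnth_nth z).
        apply: (sorted_ltn_nth _ _ s_sorted); rewrite ?inE ?size_tuple //.
        by move=> x y w; apply: ltn_trans.
      by rewrite unitfE; apply/prodf_neq0 => i _; rewrite mxE; have [_ []] := V_P i.
    apply/row_freeP; exists ((\matrix_(c, j) (c == tnth s j)%:R) *m invmx T).
    rewrite mulmxA (_ : V' *m _ = T) ?mulmxV //; apply/matrixP => i j.
    rewrite !mxE (bigD1 (tnth s j)) //= !mxE eqxx mulr1 big1 ?addr0 // => c neq_c.
    by rewrite !mxE (negPf neq_c) mulr0.
  rewrite -(eqP V'_free) (leq_trans (mxrankS _) (rank_leq_row W)) //.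
  by apply/row_subP => i; rewrite rowK; have [] := V_P i.
(* A nonzero combination of the rows of [W] has a pivot, so it cannot vanish on all columns in [S].
   Taking [t] to be [s] gives [k <= #|S|]. *)
have WP_free q (t : q.-tuple 'I_n) : {subset S <= tval t} ->
    row_free (W *m \matrix_(c < n, j < q) (c == tnth t j)%:R).
  move=> S_t; rewrite -kermx_eq0; apply/rowV0P => x /sub_kermxP.
  rewrite mulmxA => xWP0.
  apply: (row_free_inj W_free); rewrite mul0mx.
  apply/eqP/negPn/negP => /pivot_ex[c c_piv].
  have /tnthP[j cE] : c \in tval t.
    by apply/S_t/asboolP; exists (x *m W); rewrite // submxMl.
  case: c_piv => /eqP[]; move/rowP/(_ j): xWP0; rewrite [RHS]mxE => <-.
  rewrite [RHS]mxE (bigD1 (tnth t j)) //= mxE eqxx mulr1.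
  rewrite big1 ?addr0 ?cE // => d neq_d.
  by rewrite mxE (negPf neq_d) mulr0.
have s_size : size (enum S) == k.
  rewrite -cardE eqn_leq s_le -(eqP (WP_free _ s _)) ?rank_leq_col // => c.
  by rewrite mem_enum.
pose b := @SchubertCond n k (Tuple s_size) s_sorted.
have X_unit : W *m (sel b)^T \in unitmx.
  rewrite -row_free_unit -[_^T](_ : \matrix_(c < n, j < k) (c == tnth b j)%:R = _).
    by apply: WP_free => c; rewrite mem_enum.
  by apply/matrixP => c j; rewrite !mxE.
pose M := invmx (W *m (sel b)^T) *m W.
have MW : (M :=: W)%MS by apply: eqmxMfull; rewrite row_full_unit unitmx_inv.
have M_sel : M *m (sel b)^T = 1%:M by rewrite -mulmxA mulVmx.
have M_id i j : M i (tnth b j) = (i == j)%:R.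
  by have /matrixP/(_ i j) := M_sel; rewrite mul_tr_sel [RHS]mxE.
exists b, M; split=> //; split=> // i c lt_c.
(* The pivot of row [i] is a column of [b], and among these the row is nonzero only at [tnth b i];
   hence it vanishes further right. *)
have rowM_neq0 : row i M != 0.
  apply: contraTneq (eqxx i) => /rowP/(_ (tnth b i)).
  by rewrite [LHS]mxE [RHS]mxE M_id => /eqP; rewrite eqxx oner_eq0.
have [d d_piv] := pivot_ex _ rowM_neq0.
have /tnthP[j dE] : d \in tval b.
  rewrite mem_enum; apply/asboolP; exists (row i M) => //.
  by rewrite -MW row_sub.
case: d_piv; rewrite mxE dE M_id; case: (i =P j) => [<- _|_]; last by rewrite eqxx.
by move=> /(_ c lt_c); rewrite mxE.
Qed.

End Coordinates.

(** * Flags, their matrices, and Schubert cells *)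

Section Flags.
Variables (K : fieldType) (n : nat).
Implicit Types (F : flag K n) (A : 'M[K]_n).

Lemma mem_flagP F A (i : 'I_n.+1) (v : 'rV[K]_n) : flag_matrix F A ->
  reflect (forall j : 'I_n, (i <= j)%N -> (v *m invmx A) 0 j = 0) (v \in F i).
Proof.
case=> A_unit FA; rewrite -FA.
apply: (iffP (mem_span_rowsP _ _ _)) => [[x x0 ->] j|v0].
  by rewrite mulmxK // leqNgt; apply: x0.
by exists (v *m invmx A) => [j|]; rewrite ?mulmxKV // -leqNgt; apply: v0.
Qed.

(** Both sides of the defining equation have dimension [i], so one inclusion suffices;
    [flag_matrix_sub] uses the opposite one. *)
Lemma flag_matrix_sup F A : A \in unitmx ->
  (forall i : 'I_n, row i A \in F (lift ord0 i)) -> flag_matrix F A.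
Proof.
move=> A_unit rowF; split=> // i; apply/eqP; rewrite eqEdim flag_dim.
rewrite dim_span_rows ?row_free_unit // (card_ord_lt (leq_ord i)) leqnn andbT.
apply/span_subvP => v /mapP[j]; rewrite mem_filter => /andP[lt_ji _] ->.
by apply: (subvP (flag_sub F _)) (rowF j); rewrite /= /bump.
Qed.

Lemma flag_matrix_sub F A : A \in unitmx ->
    (forall (i : 'I_n.+1) v, v \in F i ->
       forall j : 'I_n, (i <= j)%N -> (v *m invmx A) 0 j = 0) ->
  flag_matrix F A.
Proof.
move=> A_unit subF; split=> // i; apply/esym/eqP; rewrite eqEdim flag_dim.
rewrite dim_span_rows ?row_free_unit // (card_ord_lt (leq_ord i)) leqnn andbT.
apply/subvP => v /subF v0; apply/mem_span_rowsP; exists (v *m invmx A) => [j|].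
  by rewrite -leqNgt; apply: v0.
by rewrite mulmxKV.
Qed.

Lemma flag_matrix_trans F A A' : flag_matrix F A -> flag_matrix F A' ->
  is_trig_mx (A' *m invmx A).
Proof.
move=> FA [_ FA']; apply/is_trig_mxP => i j lt_ij.
have : row i A' \in F (lift ord0 i).
  rewrite -FA'; apply/memv_span/(map_f (fun j => row j A')).
  by rewrite mem_filter mem_enum /= /bump leq0n add1n ltnS leqnn.
by move/(mem_flagP _ _ FA)/(_ j); rewrite -row_mul mxE; apply.
Qed.

Lemma flag_matrix_trig F A (L : 'M[K]_n) : flag_matrix F A ->
  is_trig_mx L -> L \in unitmx -> flag_matrix F (L *m A).
Proof.
move=> FA /is_trig_mxP L_trig L_unit; have [A_unit _] := FA.
apply: flag_matrix_sup => [|i]; first by rewrite unitmx_mul L_unit.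
apply/(mem_flagP _ _ FA) => j; rewrite row_mul mulmxK // mxE.
exact: L_trig.
Qed.

(** The coordinates of [v] in the rows of [invmx A] are the entries of [v *m A]; for [v] in [F i]
    those from position [i] on vanish, since the corresponding columns of [A] annihilate [F i]. *)
Lemma dual_flag_matrix_inv F A : dual_flag_matrix F A -> flag_matrix F (invmx A).
Proof.
case=> A_unit FA; apply: flag_matrix_sub; first by rewrite unitmx_inv.
move=> i v vF j le_ij; rewrite invmxK.
have : col j A \in annih (F i).
  (* The dual flag is used at index [rev_ord i], where [n - (n - i) <= j] reads [i <= j]. *)
  rewrite -[i in F i]rev_ordK -FA; apply/memv_span/(map_f (fun j => col j A)).
  rewrite mem_filter mem_enum andbT.
  by rewrite /= subSS subKn // -ltnS.
move/annihP/(_ v vF)/matrixP/(_ 0 0); rewrite [RHS]mxE => <-.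
by rewrite !mxE; apply: eq_bigr => l _; rewrite !mxE.
Qed.

Lemma unitmx_flag A : A \in unitmx -> exists F, flag_matrix F A.
Proof.
move=> A_unit.
pose G (i : 'I_n.+1) := <<[seq row j A | j : 'I_n <- enum 'I_n & (j < i)%N]>>%VS.
have G_dim i : \dim (G i) = i.
  by rewrite dim_span_rows ?row_free_unit // (card_ord_lt (leq_ord i)).
have G_sub (i j : 'I_n.+1) : (i <= j)%N -> (G i <= G j)%VS.
  move=> le_ij; apply/span_subvP => v /mapP[l].
  rewrite mem_filter => /andP[lt_li _] ->.
  apply/memv_span/(map_f (fun j => row j A)).
  by rewrite mem_filter mem_enum (leq_trans lt_li).
by exists (Flag G_dim G_sub).
Qed.

Section Schubert.
Variable k : nat.
Implicit Types b : schubert_cond n k.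

(** A combination of the rows of [M] shows its coefficients in the pivot columns, so it lies in
    [F i] exactly when it involves only rows with pivot below [i]. *)
Lemma dim_cap_flag F A b (M : 'M[K]_(k, n)) (i : 'I_n.+1) :
    flag_matrix F A -> S_space b M ->
  \dim (rowspace (M *m A) :&: F i) = #|[pred j | (tnth b j < i)%N]|.
Proof.
move=> FA MS; have [A_unit _] := FA.
have MA_free : row_free (M *m A).
  by rewrite /row_free mxrankMfree ?row_free_unit //; apply: S_space_free MS.
rewrite -(dim_span_rows _ MA_free); congr (\dim _); apply/vspaceP => v.
rewrite memv_cap mem_rowspace.
apply/andP/mem_span_rowsP => [[/submxP[x vE] /(mem_flagP _ _ FA) v0]|[x x0 vE]].
  exists x => // j; rewrite -leqNgt => /v0; rewrite vE mulmxA mulmxK //.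
  move=> <-; rewrite -[x in LHS]mulmx1 -(S_space_sel MS) mulmxA.
  by rewrite mul_tr_sel.
rewrite vE submxMl; split=> //; apply/(mem_flagP _ _ FA) => c le_ic.
rewrite mulmxA mulmxK // mxE big1 // => j _.
have [lt_ji|le_ij] := ltnP (tnth b j) i; last by rewrite x0 ?mul0r //= -leqNgt.
by case: MS => _ ->; rewrite ?mulr0 // (leq_trans lt_ji).
Qed.

(** By [dim_cap_flag] the Schubert condition counts the pivots up to [tnth b' i]; there are more
    than [i] of them exactly when pivot number [i] is among them. *)
Lemma schubert_variety_rowspace F A b b' (M : 'M[K]_(k, n)) :
    flag_matrix F A -> S_space b M ->
  schubert_variety b' F (rowspace (M *m A)) <-> forall i, (tnth b i <= tnth b' i)%N.
Proof.
move=> FA MS; have [A_unit _] := FA.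
split=> [[_ dim_gt] i|le_bb']; last split=> [|i].
- rewrite leqNgt; apply/negP => lt_b'b; have := dim_gt i.
  rewrite (dim_cap_flag _ FA MS) ltnNge.
  rewrite -[X in (_ <= X)%N](card_sc_lt b i) => /negP[].
  apply/subset_leq_card/fintype.subsetP => j; rewrite !inE /= /bump leq0n add1n ltnS.
  by move=> /leq_ltn_trans; apply.
- rewrite dim_rowspace mxrankMfree ?row_free_unit //.
  exact/eqP/(S_space_free MS).
rewrite (dim_cap_flag _ FA MS).
rewrite -(@card_ord_lt k i.+1) //.
apply/subset_leq_card/fintype.subsetP => j.
rewrite !inE /= /bump leq0n add1n !ltnS => le_ji.
by apply: leq_trans (le_bb' i); rewrite leqNgt sc_lt -leqNgt.
Qed.

(** Cell decomposition of the Grassmannian: a basis of [H], written in the basis of rows of [A], is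
    brought to echelon form. *)
Lemma rowspace_echelon A (H : {vspace 'rV[K]_n}) : A \in unitmx -> \dim H = k ->
  exists b (M : 'M[K]_(k, n)), S_space b M /\ H = rowspace (M *m A).
Proof.
move=> A_unit Hk; have [h h_free HE] := vspace_rowspace H.
move: h h_free HE; rewrite Hk => h h_free HE.
have hA_free : row_free (h *m invmx A).
  by rewrite /row_free mxrankMfree ?row_free_unit ?unitmx_inv.
have [b [M [MS MW]]] := echelon_form hA_free; exists b, M; split=> //.
rewrite HE; apply/rowspace_eq/eqmx_sym.
by rewrite -[h in (_ :=: h)%MS](mulmxKV A_unit); apply: eqmxMr.
Qed.

(** Independence of the matrix of the flag: reduction with [A] gives some condition [b'], and [H]
    lies in the closed varieties of both [b] and [b'], so each bounds the other entrywise. *)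
Lemma open_schubertP F A b H : flag_matrix F A -> open_schubert b F H ->
  exists2 M : 'M[K]_(k, n), S_space b M & H = rowspace (M *m A).
Proof.
move=> FA [A' [M' [FA' M'S HE]]]; have [A_unit _] := FA; have [A'_unit _] := FA'.
have Hk : \dim H = k.
  rewrite HE dim_rowspace mxrankMfree ?row_free_unit //.
  exact/eqP/(S_space_free M'S).
have [b' [M [MS HE']]] := rowspace_echelon A_unit Hk.
suff bE : b = b' by exists M; rewrite // bE.
have in_b : schubert_variety b F H.
  by rewrite HE; apply/(schubert_variety_rowspace _ FA' M'S).
have in_b' : schubert_variety b' F H.
  by rewrite HE'; apply/(schubert_variety_rowspace _ FA MS).
apply/val_inj/eq_from_tnth => i; apply/val_inj/eqP; rewrite /= eqn_leq.
move: in_b in_b'; rewrite {1}HE' HE.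
move=> /(schubert_variety_rowspace _ FA MS)->.
by move=> /(schubert_variety_rowspace _ FA' M'S)->.
Qed.

End Schubert.
End Flags.

(** * The bilinear system and its affine coordinate space *)

Section BilinearSystem.
Variables (K : fieldType) (n k m : nat).
Variable a : 'I_m.+1 -> schubert_cond n k.

(** Forward, [S_space_dual] supplies [N]. Backward, [H] and the row space built from the dual [M]
    are both the left kernel of [Fhat *m N]. *)
Lemma open_schubert_dual (F : flag K n) (Fhat : 'M[K]_n) (b : schubert_cond n k)
    (H : {vspace 'rV[K]_n}) : dual_flag_matrix F Fhat ->
  open_schubert b F H <-> exists2 N : 'M[K]_(n, n - k),
    Shat_space (sc_perp b) N & \dim H = k /\ annih H = colspace (Fhat *m N).
Proof.
move=> Fd; have [Fhat_unit _] := Fd; have le_kn := sc_le b.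
have FN_free (N : 'M[K]_(n, n - k)) :
    Shat_space (sc_perp b) N -> row_free (Fhat *m N)^T.
  move=> NS; rewrite trmx_mul /row_free mxrankMfree ?row_free_unit ?unitmx_tr //.
  exact: Shat_space_free NS.
have MF_free (M : 'M[K]_(k, n)) : S_space b M -> row_free (M *m invmx Fhat).
  move=> MS; rewrite /row_free mxrankMfree ?row_free_unit ?unitmx_inv //.
  exact: S_space_free MS.
have FM := dual_flag_matrix_inv Fd.
split=> [/(open_schubertP FM)[M MS ->]|[N NS [Hk annH]]].
  have [N NS MN0] := S_space_dual MS; exists N => //; split.
    by rewrite dim_rowspace; apply/eqP/MF_free.
  by apply: annih_colspace; rewrite ?MF_free ?FN_free // mulmxA mulmxKV.
have [h h_free HE] := vspace_rowspace H.
move: h h_free HE; rewrite Hk => h h_free HE.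
have hFN0 : h *m (Fhat *m N) = 0.
  by apply: annih_eq_mul0; rewrite -HE.
have [M MS MN0] := Shat_space_dual NS.
exists (invmx Fhat), M; split=> //; rewrite HE; apply/rowspace_eq.
apply: eqmx_trans (eqmx_kermx le_kn h_free (FN_free _ NS) hFN0) _.
by apply/eqmx_sym/eqmx_kermx; rewrite ?MF_free ?FN_free // mulmxA mulmxKV.
Qed.

(** The equations place each column space inside the annihilator of [rowspace (M *m F1)], and ranks
    force equality. Injectivity is uniqueness of reduced matrices; surjectivity takes [M] from the
    first cell and each [N i] from [open_schubert_dual]. *)
Lemma solutions_bij (F : 'I_m.+1 -> flag K n) (F1 : 'M[K]_n)
    (Fhat : 'I_m -> 'M[K]_n) :
    flag_matrix (F ord0) F1 ->
    (forall i : 'I_m, dual_flag_matrix (F (lift ord0 i)) (Fhat i)) ->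
  set_bij (solutions a F1 Fhat)
    (dual_diagonal m @` (\bigcap_i open_schubert (a i) (F i)))
    (subspaces_of F1 Fhat).
Proof.
move=> FF1 FFhat; have [F1_unit _] := FF1; have le_kn := sc_le (a ord0).
have Fhat_unit i : Fhat i \in unitmx by have [] := FFhat i.
have MF_free (M : 'M[K]_(k, n)) : S_space (a ord0) M -> row_free (M *m F1).
  move=> MS; rewrite /row_free mxrankMfree ?row_free_unit //.
  exact: S_space_free MS.
have FN_free i (N : 'M[K]_(n, n - k)) : Shat_space (sc_perp (a (lift ord0 i))) N ->
    row_free (Fhat i *m N)^T.
  move=> NS; rewrite trmx_mul /row_free mxrankMfree ?row_free_unit ?unitmx_tr //.
  exact: Shat_space_free NS.
split.
- move=> [M N] [[/= MS NS] eqs].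
  have annE i : annih (rowspace (M *m F1)) = colspace (Fhat i *m N i).
    by apply: annih_colspace; rewrite ?MF_free ?FN_free // mulmxA eqs.
  exists (rowspace (M *m F1)) => [i _|].
    case: (unliftP ord0 i) => [j ->|->]; last by exists F1, M.
    apply/(open_schubert_dual _ _ (FFhat j)); exists (N j) => //; split=> //.
    by rewrite dim_rowspace; apply/eqP/MF_free.
  by congr (_, _); apply/ffunP => i; rewrite !ffunE; apply: annE.
- move=> [M N] [M' N'] /set_mem[[/= MS NS] _] /set_mem[[/= M'S N'S] _].
  case=> /rowspace_eq eqM /ffunP eqN; congr (_, _).
    apply: (S_space_inj MS M'S).
    by rewrite -[M](mulmxK F1_unit) -[M'](mulmxK F1_unit); apply: eqmxMr.
  apply/ffunP => i; apply: (Shat_space_inj (NS i) (N'S i)).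
  have := eqN i; rewrite !ffunE => /colspace_eq eqNi.
  rewrite -[N i](mulKmx (Fhat_unit i)) -[N' i](mulKmx (Fhat_unit i)).
  by rewrite trmx_mul [X in (_ :=: X)%MS]trmx_mul; apply: eqmxMr.
- move=> _ [H HX <-].
  have [M MS HE] := open_schubertP FF1 (HX ord0 I).
  have /choice[N N_P] : forall i : 'I_m, exists N : 'M[K]_(n, n - k),
      Shat_space (sc_perp (a (lift ord0 i))) N /\ annih H = colspace (Fhat i *m N).
    move=> i.
    have /(open_schubert_dual _ _ (FFhat i))[N NS [_ annH]] := HX (lift ord0 i) I.
    by exists N.
  exists (M, [ffun i => N i]); last first.
    rewrite /subspaces_of /dual_diagonal /= -HE; congr (_, _).
    by apply/ffunP => i; rewrite !ffunE; have [_ ->] := N_P i.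
  split=> [|i]; first by split=> //= i; rewrite ffunE; have [] := N_P i.
  have [_ annH] := N_P i; rewrite /= ffunE -mulmxA.
  by apply: annih_eq_mul0; rewrite -HE.
Qed.

Lemma bilin_eqn_bilinear (F1 : 'M[K]_n) (Fhat : 'I_m -> 'M[K]_n)
  (e : eqn_index n k m) : bilinear_for *%R *%R (bilin_eqn F1 Fhat e).
Proof.
split=> [N c M M'|M c N N'] /=; rewrite /bilin_eqn.
  by rewrite !mulmxDl -!scalemxAl !mxE.
by rewrite mulmxDr -scalemxAr !mxE.
Qed.

Lemma solutions_eqns (F1 : 'M[K]_n) (Fhat : 'I_m -> 'M[K]_n) :
  solutions a F1 Fhat = [set x | coordinates a x /\
    forall e : eqn_index n k m, bilin_eqn F1 Fhat e x.1 (x.2 e.1.1) = 0].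
Proof.
apply/seteqP; split=> x [xC eqs]; split=> //.
  by move=> [[i r] c]; rewrite /bilin_eqn /= eqs mxE.
by move=> i; apply/matrixP => r c; rewrite [RHS]mxE; apply: (eqs (i, r, c)).
Qed.

Lemma card_eqn_index : #|eqn_index n k m| = (k * (n - k) * m)%N.
Proof. by rewrite !card_prod !card_ord -mulnA mulnC. Qed.

Let free_entries := [pred t : 'I_m.+1 * ('I_n * 'I_n) | t.2 \in descents (a t.1)].

Lemma card_free_entries : #|free_entries| = (k * (n - k) * m.+1 - total_codim a)%N.
Proof.
rewrite (card_pred_fibers (fun i => descents (a i))).
suff -> : (k * (n - k) * m.+1 = total_codim a + \sum_i #|descents (a i)|)%N.
  by rewrite addKn.
rewrite -big_split /= (eq_bigr (fun=> k * (n - k))%N) => [|i _].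
  by rewrite sum_nat_const card_ord mulnC.
exact: codim_descents.
Qed.

Lemma coordinates_affine :
  affine_space_of_dim (@coordinates K n k m a) (k * (n - k) * m.+1 - total_codim a).
Proof.
rewrite -card_free_entries.
pose s := [seq t <- enum {: 'I_m.+1 * ('I_n * 'I_n)} | free_entries t].
have s_uniq : uniq s by rewrite filter_uniq ?enum_uniq.
(* [g t] is the matrix unit at the free entry [t], in the component given by [t.1]; rows of [M] are
   labelled by their pivots, columns of [N] by [perp_elt]. *)
pose g (t : 'I_m.+1 * ('I_n * 'I_n)) : unknowns K n k m :=
  (\matrix_(i, c) (t == (ord0, (tnth (a ord0) i, c)))%:R,
   [ffun l => \matrix_(r, j)
     (t == (lift ord0 l, (r, perp_elt (a (lift ord0 l)) j)))%:R]).
have sum_delta (y : 'I_m.+1 * ('I_n * 'I_n) -> K) u :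
    \sum_(t <- s) y t * (t == u)%:R = if free_entries u then y u else 0.
  rewrite big_filter big_enum_cond /= big_mkcond (bigD1 u) //= big1 ?addr0.
    by rewrite eqxx mulr1.
  by move=> t /negPf ->; rewrite mulr0; case: ifP.
have sum_g1 (y : 'I_m.+1 * ('I_n * 'I_n) -> K) i c u :
    u = (ord0, (tnth (a ord0) i, c)) ->
    (\sum_(t <- s) y t *: g t).1 i c = if free_entries u then y u else 0.
  move=> uE; rewrite -sum_delta raddf_sum summxE; apply: eq_bigr => t _.
  by rewrite !mxE uE.
have sum_g2 (y : 'I_m.+1 * ('I_n * 'I_n) -> K) l r j u :
    u = (lift ord0 l, (r, perp_elt (a (lift ord0 l)) j)) ->
    (\sum_(t <- s) y t *: g t).2 l r j = if free_entries u then y u else 0.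
  move=> uE; rewrite -sum_delta raddf_sum sum_ffunE summxE.
  by apply: eq_bigr => t _; rewrite !ffunE !mxE uE.
pose x0 : unknowns K n k m :=
  (sel K (a ord0), [ffun l => cosel K (a (lift ord0 l))]).
exists x0, <<[seq g t | t <- s]>>%VS; split.
  rewrite (eqnP (free_map s_uniq _)).
    by rewrite size_map /s enumT cardE.
  move=> y y0 [i [r c]]; rewrite mem_filter => /andP[] /[dup] free_t.
  move=> /and3P[/= rb cb _] _; move: free_t.
  case: (unliftP ord0 i) rb cb => [l ->|->] rb cb free_t.
    have /perp_eltP[j cE] := cb.
    move: y0 => /(congr1 (fun x : unknowns K n k m => x.2 l r j)).
    by rewrite (sum_g2 _ _ _ _ _ (erefl _)) ffunE !mxE -cE free_t.
  have /tnthP[j rE] := rb.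
  move: y0 => /(congr1 (fun x : unknowns K n k m => x.1 j c)).
  by rewrite (sum_g1 _ _ _ _ (erefl _)) !mxE -rE free_t.
apply/seteqP; split=> [x [/S_spaceE x1 x2]|x] /=.
  apply/(mem_span_map _ _ s_uniq).
  (* The products with transposes re-index the rows of the first component, or the columns of the
     others, by these labels. *)
  pose y (t : 'I_m.+1 * ('I_n * 'I_n)) := if unlift ord0 t.1 is Some l
    then ((x - x0).2 l *m (cosel K (a (lift ord0 l)))^T) t.2.1 t.2.2
    else ((sel K (a ord0))^T *m (x - x0).1) t.2.1 t.2.2.
  exists y; apply: injective_projections.
    apply/matrixP => i c; rewrite (sum_g1 _ _ _ _ (erefl _)).
    rewrite /y /= unlift_none mul_tr_sel_l; case: ifPn => // ic.
    by rewrite !mxE x1 // subrr.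
  apply/ffunP => l; apply/matrixP => r j; rewrite (sum_g2 _ _ _ _ _ (erefl _)).
  rewrite /y /= liftK mul_tr_cosel; case: ifPn => // rj.
  by have /Shat_spaceE x2l := x2 l; rewrite !ffunE !mxE x2l // subrr.
move=> /(mem_span_map _ _ s_uniq)[y /(canRL (subrK _)) ->].
split=> [|l].
  apply/S_spaceE => i c /negPf ic.
  by rewrite mxE (sum_g1 _ _ _ _ (erefl _)) [free_entries _]ic add0r mxE.
apply/Shat_spaceE => r j /negPf rj.
by rewrite ffunE mxE (sum_g2 _ _ _ _ _ (erefl _)) [free_entries _]rj add0r ffunE mxE.
Qed.

End BilinearSystem.

(** * Parameter count for flags whose cells share a subspace *)

Section GeneralPosition.
Variables (K : fieldType) (n k m : nat).

(* If M A = g h with M in reduced form, then the pivot rows of A are determined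
   by its other rows and by g, h and the free entries of M. *)
Lemma pivot_rows (b : schubert_cond n k) (M h : 'M[K]_(k, n)) (g : 'M[K]_k)
    (A : 'M[K]_n) (A0 := A - (sel K b)^T *m (sel K b *m A)) :
    S_space b M -> M *m A = g *m h ->
  A = A0 + (sel K b)^T *m (g *m h - (M - sel K b) *m A0).
Proof.
move=> MS MA; have selS : sel K b *m (sel K b)^T = 1%:M.
  apply/matrixP => i j; rewrite mul_sel !mxE eq_sym (inj_eq (@sc_inj _ _ b)).
  by rewrite eq_sym.
suff -> : (M - sel K b) *m A0 = g *m h - sel K b *m A by rewrite subKr subrK.
have MselS : (M - sel K b) *m (sel K b)^T = 0.
  by rewrite mulmxBl (S_space_sel MS) selS subrr.
by rewrite /A0 mulmxBr (mulmxA (M - _)) MselS mul0mx subr0 mulmxBl MA.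
Qed.

Variables (b : 'I_m -> schubert_cond n k) (c : schubert_cond n k).

(** For each [i], rows outside [b i] hold the non-pivot rows of [A i], positions with both indices
    in [b i] hold [g], and descents hold the free entries of [M]; only the ascents are left out. The
    second summand holds the entries of [h] off its pivot columns. *)
Let params : pred ('I_m * ('I_n * 'I_n) + 'I_n * 'I_n) := fun t =>
  match t with
  | inl u => u.2 \notin ascents (b u.1)
  | inr p => (p.1 \in tval c) && (p.2 \notin tval c)
  end.

Lemma card_params : (#|params| + total_codim b = m * n * n + k * (n - k))%N.
Proof.
have -> : #|params| =
    (#|[pred u : 'I_m * ('I_n * 'I_n) | u.2 \notin ascents (b u.1)]| +
    #|[pred p : 'I_n * 'I_n | (p.1 \in tval c) && (p.2 \notin tval c)]|)%N.
  by rewrite -!sum1_card big_sumType.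
have -> : #|[pred p : 'I_n * 'I_n | (p.1 \in tval c) && (p.2 \notin tval c)]| =
    (k * (n - k))%N.
  rewrite -(eq_card (A := [pred p : 'I_n * 'I_n |
    [&& p.1 \in tval c, p.2 \notin tval c & true]])); last first.
    by move=> p; rewrite !inE andbT.
  rewrite (card_pairs_from c (fun _ _ => true)).
  rewrite (eq_bigr (fun=> (n - k)%N)) => [|i _].
    by rewrite sum_nat_const card_ord.
  by rewrite -(card_sc_complement c); apply: eq_card => d; rewrite !inE andbT.
have -> : total_codim b =
    #|[pred u : 'I_m * ('I_n * 'I_n) | u.2 \in ascents (b u.1)]|.
  rewrite (card_pred_fibers (fun i => ascents (b i))).
  by apply: eq_bigr => i _; rewrite codimE.
have := cardC [pred u : 'I_m * ('I_n * 'I_n) | u.2 \in ascents (b u.1)].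
rewrite !card_prod !card_ord [X in (_ + X = _ -> _)%N](_ : _ =
  #|[pred u : 'I_m * ('I_n * 'I_n) | u.2 \notin ascents (b u.1)]|).
  by rewrite mulnA => <-; rewrite addnAC; congr (_ + _)%N; rewrite addnC.
by apply: eq_card => u.
Qed.

(** Each [i] saves [codim (b i)] parameters against the [n * n] entries of [A i], while [h] costs
    [k * (n - k)]. So there are fewer parameters than entries, and [algebraic_dependence]
    applies. *)
Lemma common_subspace_locus : (k * (n - k) < total_codim b)%N ->
  exists2 p : {mpoly K[#|{: 'I_m * 'I_n * 'I_n}|]}, p != 0 &
    forall (A : 'I_m -> 'M[K]_n) (h : 'M[K]_(k, n)), S_space c h ->
      (forall i, exists2 M : 'M[K]_(k, n), S_space (b i) M & (M *m A i <= h)%MS) ->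
    p.@[entries A] = 0.
Proof.
move=> lt_codim; pose T : finType := {t | params t}.
pose mp := {mpoly K[#|T|]}.
(* The default 0 outside [params] produces the zeros of [M] at ascents and of the correction to [h]
   in its pivot columns. *)
pose var t : mp := if insub t is Some u then 'X_(enum_rank (u : T)) else 0.
pose hP : 'M[mp]_(k, n) := \matrix_(j, d)
  ((d == tnth c j)%:R + var (inr (tnth c j, d))).
pose gP i : 'M[mp]_k := \matrix_(j, l) var (inl (i, (tnth (b i) j, tnth (b i) l))).
pose MP i : 'M[mp]_(k, n) := \matrix_(j, d)
  if d \in tval (b i) then 0 else var (inl (i, (tnth (b i) j, d))).
pose RP i : 'M[mp]_n := \matrix_(r, d)
  if r \in tval (b i) then 0 else var (inl (i, (r, d))).
pose AP i := RP i +
  (map_mx (@mpolyC _ K) (sel K (b i)))^T *m (gP i *m hP - MP i *m RP i).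
pose f (v : 'I_#|{: 'I_m * 'I_n * 'I_n}|) : mp :=
  let: (i, r, d) := enum_val v in AP i r d.
have lt_dN : (#|T| < #|{: 'I_m * 'I_n * 'I_n}|)%N.
  have -> : #|T| = #|params| by rewrite card_sig; apply: eq_card.
  by rewrite -(ltn_add2r (total_codim b)) card_params !card_prod !card_ord ltn_add2l.
have [p p_neq0 p0] := algebraic_dependence f lt_dN; exists p => // A h hS AM.
have /choice[Mg Mg_P] : forall i, exists Mg : 'M[K]_(k, n) * 'M[K]_k,
    S_space (b i) Mg.1 /\ Mg.1 *m A i = Mg.2 *m h.
  by move=> i; have [M MS /submxP[g MA]] := AM i; exists (M, g).
(* The parameter values at the given matrices; the selections move the entries of [g], [M] and [h]
   to the positions named by the pivots. *)
pose w t := match t with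
  | inl (i, (r, d)) => if r \notin tval (b i) then A i r d else
      if d \in tval (b i) then ((sel K (b i))^T *m ((Mg i).2 *m sel K (b i))) r d
      else ((sel K (b i))^T *m (Mg i).1) r d
  | inr (x, d) => ((sel K c)^T *m h) x d
  end.
pose v (x : 'I_#|T|) := w (val (enum_val x)).
have var_eval t : (var t).@[v] = if params t then w t else 0.
  rewrite /var; case: insubP => [u -> <-|/negPf ->]; last by rewrite meval0.
  by rewrite mevalXU /v enum_rankK.
have hE : map_mx (meval v) hP = h.
  apply/matrixP => j d; rewrite !mxE mevalD var_eval /= mem_tnth mul_tr_sel_l /=.
  rewrite rmorph_nat; case: ifPn => [d_notin|].
    by case: eqP d_notin => [->|_ _]; rewrite ?mem_tnth ?add0r.
  rewrite negbK => /tnthP[l ->]; rewrite addr0 (inj_eq (@sc_inj _ _ c)) eq_sym.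
  by case: hS => ->.
have gE i : map_mx (meval v) (gP i) = (Mg i).2.
  apply/matrixP => j l; rewrite !mxE var_eval /= !inE /= !mem_tnth /=.
  rewrite mul_tr_sel_l mxE (bigD1 l) //= mxE eqxx mulr1.
  rewrite big1 ?addr0 // => l' neq_l.
  by rewrite mxE (inj_eq (@sc_inj _ _ (b i))) eq_sym (negPf neq_l) mulr0.
have ME i : map_mx (meval v) (MP i) = (Mg i).1 - sel K (b i).
  have [[M_id M_0] _] := Mg_P i; apply/matrixP => j d; rewrite !mxE.
  case: ifPn => [/tnthP[l ->]|d_notin].
    by rewrite meval0 M_id (inj_eq (@sc_inj _ _ (b i))) eq_sym subrr.
  have /negPf-> : d != tnth (b i) j.
    by apply: contraNneq d_notin => ->; apply: mem_tnth.
  rewrite var_eval /= !inE /= mem_tnth (negPf d_notin) /= mul_tr_sel_l subr0.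
  by case: ltnP => // /M_0 ->.
have RE i : map_mx (meval v) (RP i) = A i - (sel K (b i))^T *m (sel K (b i) *m A i).
  apply/matrixP => r d; rewrite mxE [RP i r d]mxE [RHS]mxE [X in _ + X]mxE.
  case: ifPn => [/tnthP[j ->]|r_notin].
    by rewrite meval0 mul_tr_sel_l mul_sel subrr.
  rewrite var_eval /= !inE /= (negPf r_notin) /=.
  rewrite [X in _ - X]mxE big1 ?subr0 // => j _.
  rewrite !mxE; case: eqP => [rE|_]; last by rewrite mul0r.
  by rewrite rE mem_tnth in r_notin.
have AE i : map_mx (meval v) (AP i) = A i.
  have [MS MA] := Mg_P i; rewrite [RHS](pivot_rows MS MA).
  rewrite map_mxD map_mxM map_mxB !map_mxM hE gE ME RE; congr (_ + _ *m _).
  by apply/matrixP => r j; rewrite !mxE; apply: mevalC.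
rewrite -[RHS](p0 v); apply: meval_eq => x; rewrite /entries /f.
by case: (enum_val x) => [[i r] d]; rewrite -[in LHS]AE mxE.
Qed.

End GeneralPosition.

(** * Zariski-general flags and the closed intersection *)

Section GeneralFlags.
Variables (K : fieldType) (n m : nat).

Local Notation mp := {mpoly K[#|{: 'I_m * 'I_n * 'I_n}|]}.

Lemma entries_onto (v : 'I_#|{: 'I_m * 'I_n * 'I_n}| -> K) :
  exists A : 'I_m -> 'M[K]_n, entries A =1 v.
Proof.
exists (fun i => \matrix_(r, d) v (enum_rank (i, r, d))) => x.
rewrite /entries; case xE: (enum_val x) => [[i r] d].
by rewrite mxE -xE enum_valK.
Qed.

(* The flags are represented by cosets of matrices modulo lower triangular ones,
   so the open set is the union of the triangular translates of the locus p <> 0. *)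
Lemma for_general_flags_nonvanishing (p : mp) (P : ('I_m -> flag K n) -> Prop) :
    [pchar K] =i pred0 -> p != 0 ->
    (forall (F : 'I_m -> flag K n) (A : 'I_m -> 'M[K]_n),
       (forall i, flag_matrix (F i) (A i)) -> p.@[entries A] != 0 -> P F) ->
  for_general_flags P.
Proof.
move=> charK p_neq0 pP.
pose U (F : 'I_m -> flag K n) := exists2 A : 'I_m -> 'M[K]_n,
  forall i, flag_matrix (F i) (A i) & p.@[entries A] != 0.
exists U; split; last by move=> F [A]; apply: pP.
  (* The largest admissible family: all polynomials whose nonvanishing puts the flags in [U]. *)
  exists [set q : mp | forall (F : 'I_m -> flag K n) (A : 'I_m -> 'M[K]_n),
    (forall i, flag_matrix (F i) (A i)) -> q.@[entries A] != 0 -> U F].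
  move=> F A FA; split=> [[A' FA' pA']|[q qU]]; last exact: qU.
  pose L i := A' i *m invmx (A i).
  have A_unit i : A i \in unitmx by have [] := FA i.
  have A'_unit i : A' i \in unitmx by have [] := FA' i.
  (* The translate of [p] by the triangular [L]: it is nonzero at [A] because [L i *m A i] is
     [A' i], and [L i *m B i] represents the same flag as [B i]. *)
  pose q := p \mPo [tuple (let: (i, r, d) := enum_val x in
    \sum_l L i r l *: 'X_(enum_rank (i, l, d))) | x < #|{: 'I_m * 'I_n * 'I_n}|].
  have qE B : q.@[entries B] = p.@[entries (fun i => L i *m B i)].
    rewrite comp_mpoly_meval; apply: meval_eq => x; rewrite tnth_mktuple /entries.
    case: (enum_val x) => [[i r] d]; rewrite mxE linear_sum /=.
    by apply: eq_bigr => l _; rewrite mevalZ mevalXU enum_rankK.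
  exists q; last first.
    rewrite qE (meval_eq (v2 := entries A')) // => x; rewrite /entries.
    by case: (enum_val x) => [[i r] d]; rewrite /L mulmxKV.
  move=> G B GB; rewrite qE => pLB; exists (fun i => L i *m B i) => // i.
  apply: flag_matrix_trig (GB i) (flag_matrix_trans (FA i) (FA' i)) _.
  by rewrite unitmx_mul unitmx_inv A_unit A'_unit.
(* At a point where [p * D] is nonzero the matrices are invertible, hence come from flags; so [U] is
   nonempty. *)
pose D : mp := \prod_i \det (\matrix_(r < n, d < n) ('X_(enum_rank (i, r, d)) : mp)).
have DE A : D.@[entries A] = \prod_i \det (A i).
  rewrite rmorph_prod; apply: eq_bigr => i _; rewrite -det_map_mx; congr (\det _).
  by apply/matrixP => r d; rewrite !mxE /= mevalXU /entries enum_rankK.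
have D_neq0 : D != 0.
  apply: contraTneq (oner_neq0 K) => D0; have := DE (fun=> 1%:M).
  by rewrite D0 meval0 big1 => [<-|i _]; rewrite ?eqxx ?det1.
have [v] := mpoly_nonvanishing charK (mulf_neq0 p_neq0 D_neq0).
have [A /meval_eq AE] := entries_onto v.
rewrite -AE mevalM mulf_eq0 negb_or DE => /andP[pA /prodf_neq0 detA].
have /choice[F FA] : forall i, exists F, flag_matrix F (A i).
  by move=> i; apply: unitmx_flag; rewrite unitmxE unitfE detA.
by exists F, A.
Qed.

End GeneralFlags.

(* A point of the closed but not of the open intersection lies in smaller open
   cells whose codimensions add up to more than k (n - k). *)
Lemma schubert_problem_general (K : fieldType) (n k m : nat)
    (a : 'I_m.+1 -> schubert_cond n k) : [pchar K] =i pred0 ->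
  for_general_flags (fun F : 'I_m.+1 -> flag K n => schubert_problem a ->
    \bigcap_i open_schubert (a i) (F i) = \bigcap_i schubert_variety (a i) (F i)).
Proof.
move=> charK; pose mp := {mpoly K[#|{: 'I_m.+1 * 'I_n * 'I_n}|]}.
(* The first component lists the cells relative to the flags, the second is the cell of the common
   subspace relative to the coordinate flag. Choices of small codimension receive the polynomial
   1. *)
pose I := ({ffun 'I_m.+1 -> schubert_cond n k} * schubert_cond n k)%type.
have /choice[p p_P] : forall x : I, exists p : mp, p != 0 /\
    ((k * (n - k) < total_codim x.1)%N ->
     forall (A : 'I_m.+1 -> 'M[K]_n) (h : 'M[K]_(k, n)), S_space x.2 h ->
       (forall i, exists2 M : 'M[K]_(k, n),
          S_space (x.1 i) M & (M *m A i <= h)%MS) ->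
     p.@[entries A] = 0).
  move=> [b c] /=; have [/(common_subspace_locus K c)[p p_neq0 p0]|_] := ltnP.
    by exists p.
  by exists 1; rewrite oner_neq0.
apply: (@for_general_flags_nonvanishing _ _ _ (\prod_(x : I) p x)) => //.
  by apply/prodf_neq0 => x _; have [] := p_P x.
move=> F A FA; rewrite rmorph_prod => /prodf_neq0 pA schub.
have A_unit i : A i \in unitmx by have [] := FA i.
apply/seteqP; split=> H HX.
  move=> i _; have [M MS ->] := open_schubertP (FA i) (HX i Logic.I).
  exact/(schubert_variety_rowspace _ (FA i) MS).
have Hk : \dim H = k by have [] := HX ord0 Logic.I.
have /choice[b b_P] : forall i, exists (b : schubert_cond n k) (M : 'M[K]_(k, n)),
    S_space b M /\ H = rowspace (M *m A i).
  by move=> i; apply: rowspace_echelon.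
have [c [h [hS]]] := rowspace_echelon (unitmx1 K n) Hk; rewrite mulmx1 => Hh.
have le_ba i j : (tnth (b i) j <= tnth (a i) j)%N.
  have [M [MS HE]] := b_P i; have := HX i Logic.I.
  by rewrite {1}HE => /(schubert_variety_rowspace _ (FA i) MS).
have le_codim : (total_codim b <= total_codim a)%N.
  rewrite schub leqNgt; apply/negP => gt_codim.
  have /eqP[] := pA ([ffun i => b i], c) isT.
  have [_ p0] := p_P ([ffun i => b i], c); apply: (p0 _ _ h) => // [|i].
    by rewrite /total_codim; under eq_bigr => i _ do rewrite ffunE.
  have [M [MS HE]] := b_P i; exists M; first by rewrite ffunE.
  by have /rowspace_eq <- : rowspace (M *m A i) = rowspace h by rewrite -HE.
move=> i _; have [M [MS HE]] := b_P i; exists (A i), M; split=> //.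
suff <- : b i = a i by [].
(* A single strict inequality of codimensions would make the total for [b] exceed that for [a]. *)
apply: codim_le_eq (le_ba i) _; rewrite leqNgt; apply/negP => lt_i.
suff: (total_codim a < total_codim b)%N by rewrite ltnNge le_codim.
rewrite /total_codim (bigD1 i) //= [X in (_ < X)%N](bigD1 i) //=.
by rewrite -addSn leq_add // leq_sum // => j _; apply: codim_le (le_ba j).
Qed.

Theorem theorem5p2p11 (R : realType) (n k m : nat) (k_gt0 : (0 < k)%N)
    (k_lt_n : (k < n)%N) (a : 'I_m.+1 -> schubert_cond n k) :
  for_general_flags (fun F : 'I_m.+1 -> flag (CC R) n =>
    let X := \bigcap_i open_schubert (a i) (F i) in
    forall (F1 : 'M[CC R]_n) (Fhat : 'I_m -> 'M[CC R]_n),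
    flag_matrix (F ord0) F1 ->
    (forall i : 'I_m, dual_flag_matrix (F (lift ord0 i)) (Fhat i)) ->
    [/\ set_bij (solutions a F1 Fhat) (dual_diagonal m @` X)
          (subspaces_of F1 Fhat),
        (forall e : eqn_index n k m, bilinear_for *%R *%R (bilin_eqn F1 Fhat e)) /\
        (solutions a F1 Fhat =
           [set x | coordinates a x /\
              forall e : eqn_index n k m, bilin_eqn F1 Fhat e x.1 (x.2 e.1.1) = 0]),
        #|eqn_index n k m| = (k * (n - k) * m)%N /\
        affine_space_of_dim (@coordinates (CC R) n k m a)
          (k * (n - k) * m.+1 - total_codim a)
      & schubert_problem a ->
        X = \bigcap_i schubert_variety (a i) (F i) /\
        affine_space_of_dim (@coordinates (CC R) n k m a) #|eqn_index n k m|]).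
Proof.
have charC : [pchar CC R] =i pred0 by exact: (@Num.Theory.pchar_num R[i]).
have [U [U_open U_neq0 UP]] := schubert_problem_general a charC.
exists U; split=> // F /UP closedF X F1 Fhat FF1 FFhat; split.
- exact: solutions_bij.
- by split=> [e|]; [apply: bilin_eqn_bilinear | apply: solutions_eqns].
- by split; [apply: card_eqn_index | apply: coordinates_affine].
move=> schub; split; first exact: closedF.
(* Here [k * (n - k) * m.+1 - k * (n - k)] is [k * (n - k) * m], the number of equations. *)
have := coordinates_affine (CC R) a.
by rewrite schub card_eqn_index mulnS addKn.
Qed.
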